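(* Let $m$ and $n$ be positive integers such that $n\geq m+1$. (a) If $A\subseteq\mathbb{R}^n$ is a Lebesgue-measurable set such that $\bar{\delta}_n(A)>0$, then there exists a number $V_0>0$ (depending on $A$) such that for every number $V\geq V_0$ there exists an $m$-dimensional rectangular box of $m$-volume $V$ with all $2^m$ vertices in $A$. (b) For every finite measurable coloring of $\mathbb{R}^n$ there exist a color-class $\mathscr{C}$ and a number $V_0>0$ such that for every number $V\geq V_0$ there exists an $m$-dimensional rectangular box of $m$-volume $V$ with all $2^m$ vertices in $\mathscr{C}$. Moreover, in both parts the rectangular boxes can be chosen to have $m-1$ edges parallel to the first $m-1$ coordinate vectors and the last edge parallel to the linear span of the remaining $n-m+1$ coordinate vectors.
   Context: The upper Banach density of a measurable set $A\subseteq\mathbb{R}^n$ is $\bar{\delta}_n(A):=\limsup_{R\to\infty}\sup_{x\in\mathbb{R}^n}\frac{|A\cap(x+[0,R]^n)|}{R^n}$, where $|\cdot|$ is Lebesgue measure. A finite measurable coloring of $\mathbb{R}^n$ is a partition of $\mathbb{R}^n$ into finitely many Lebesgue-measurable sets, called color-classes. An $m$-dimensional rectangular box has vertices $p+\sum_{j\in T}v_j$, $T\subseteq\{1,\ldots,m\}$, where $p\in\mathbb{R}^n$ and $v_1,\ldots,v_m\in\mathbb{R}^n$ are nonzero mutually orthogonal vectors (its edges from $p$); its $m$-volume is $|v_1|\cdots|v_m|$. *)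

(* Defs.v *)
From HB Require Import structures.
From mathcomp Require Import all_boot all_order all_algebra.
From mathcomp Require Import all_classical all_reals all_analysis.

Set Implicit Arguments.
Unset Strict Implicit.
Unset Printing Implicit Defensive.

Import Order.TTheory GRing.Theory Num.Theory.
Import numFieldNormedType.Exports.

Local Open Scope classical_set_scope.
Local Open Scope ring_scope.

Definition rV_display : measure_display.
Proof. exact: default_measure_display. Qed.

Section borel_rV.
Context {R : realType} (n : nat).

Definition coord_rV (i : 'I_n) (x : 'rV[R]_n) : measurableTypeR R := x 0 i.

Let rV_set0 : g_sigma_preimage coord_rV set0.
Proof. exact: sigma_algebra0. Qed.

Let rV_setC (A : set 'rV[R]_n) :
  g_sigma_preimage coord_rV A -> g_sigma_preimage coord_rV (~` A).
Proof. exact: sigma_algebraC. Qed.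

Let rV_bigcup (F : (set 'rV[R]_n)^nat) :
  (forall i, g_sigma_preimage coord_rV (F i)) ->
  g_sigma_preimage coord_rV (\bigcup_i (F i)).
Proof. exact: sigma_algebra_bigcup. Qed.

HB.instance Definition _ := @isMeasurable.Build rV_display
  'rV[R]_n (g_sigma_preimage coord_rV) rV_set0 rV_setC rV_bigcup.

Lemma measurable_coord_rV (i : 'I_n) :
  measurable_fun [set: 'rV[R]_n] (coord_rV i).
Proof.
move=> _ Y mY; rewrite setTI; apply: sub_sigma_algebra => /=.
rewrite -bigcup_seq/=; exists i => /=; first by rewrite mem_index_enum.
by exists Y => //; rewrite setTI.
Qed.

Lemma measurable_fun_rV d (T : measurableType d) (f : T -> 'rV[R]_n) :
  (forall i, measurable_fun [set: T] (coord_rV i \o f)) ->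
  measurable_fun [set: T] f.
Proof.
move=> mf _ Y mY.
have : g_sigma_preimage (fun i => coord_rV i \o f) `<=` measurable.
  apply: smallest_sub; first exact: sigma_algebra_measurable.
  rewrite -bigcup_seq/=; apply: bigcup_sub => i _.
  by move=> A [B mB <-]; exact: mf.
rewrite g_sigma_preimage_comp; apply.
by exists Y => //.
Qed.

Lemma measurable_box_rV (a b : 'rV[R]_n) :
  measurable [set x : 'rV[R]_n | forall i, a 0 i <= x 0 i <= b 0 i].
Proof.
rewrite (_ : [set _ | _] =
    \bigcap_i (coord_rV i @^-1` `[a 0 i, b 0 i]%classic)); last first.
  by apply/seteqP; split => x /= h i; have := h i; rewrite /= in_itv//=; apply.
apply: fin_bigcap_measurable => // i _.
by rewrite -[X in measurable X]setTI; exact: measurable_coord_rV.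
Qed.

End borel_rV.

Definition cons_rV {R : realType} (n : nat) (x : measurableTypeR R * 'rV[R]_n) :
  'rV[R]_n.+1 := row_mx (const_mx (x.1 : R)) x.2 : 'rV_(1 + n).

Fixpoint borel_lebesgue (R : realType) (n : nat) : set 'rV[R]_n -> \bar R :=
  if n is n'.+1 then
    pushforward (@lebesgue_measure R \x @borel_lebesgue R n')%E (@cons_rV R n')
  else dirac (0 : 'rV[R]_0).

Section borel_lebesgue_measure.
Context {R : realType}.

Let uncons_rV n (x : 'rV[R]_n.+1) : measurableTypeR R * 'rV[R]_n :=
  (coord_rV ord0 x, \row_j x 0 (lift ord0 j)).

Let cons_rV0 n (x : measurableTypeR R) (y : 'rV[R]_n) :
  cons_rV (x, y) 0 ord0 = x.
Proof.
have e : row_mx (const_mx (x : R)) y 0 (lshift n (0 : 'I_1)) = x.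
  by rewrite row_mxEl mxE.
by rewrite -[RHS]e; congr (fun_of_matrix _ _ _); exact/val_inj.
Qed.

Let cons_rVS n (x : measurableTypeR R) (y : 'rV[R]_n) j :
  cons_rV (x, y) 0 (lift ord0 j) = y 0 j.
Proof.
have e : row_mx (const_mx (x : R)) y 0 (rshift 1 j) = y 0 j by rewrite row_mxEr.
by rewrite -[RHS]e; congr (fun_of_matrix _ _ _); exact/val_inj.
Qed.

Let uncons_rVK n : cancel (@cons_rV R n) (@uncons_rV n).
Proof.
move=> [x y]; congr pair; first exact: cons_rV0.
by apply/rowP => j; rewrite mxE cons_rVS.
Qed.

Lemma measurable_cons_rV n : measurable_fun setT (@cons_rV R n).
Proof.
apply: measurable_fun_rV => i; case: (unliftP ord0 i) => [j|] ->.
  rewrite (_ : _ \o _ = coord_rV j \o snd); last first.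
    by apply/funext => -[x y] /=; rewrite /coord_rV cons_rVS.
  by apply: measurableT_comp => //; exact: measurable_coord_rV.
rewrite (_ : _ \o _ = fst) //; apply/funext => -[x y] /=.
by rewrite /coord_rV cons_rV0.
Qed.

Let measurable_uncons_rV n : measurable_fun setT (@uncons_rV n).
Proof.
apply: measurable_fun_pair; first exact: measurable_coord_rV.
apply: measurable_fun_rV => i.
rewrite (_ : _ \o _ = coord_rV (lift ord0 i)); first exact: measurable_coord_rV.
by apply/funext => x; rewrite /coord_rV /= mxE.
Qed.

Let borel_lebesgue_is_measure n :
  exists mu : {sigma_finite_measure set 'rV[R]_n -> \bar R},
    borel_lebesgue (n := n) = mu.
Proof.
elim: n => [|n [mu IH]].
  by exists (@dirac _ 'rV[R]_0 0 R).
pose l : {sigma_finite_measure set (measurableTypeR R) -> \bar R} :=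
  @lebesgue_measure R.
pose mup : {measure set (measurableTypeR R * 'rV[R]_n)%type -> \bar R} :=
  (l \x mu)%E.
pose m := pushforward mup (@cons_rV R n).
have sm : sigma_finite setT m.
  have [F FT Ffin] : sigma_finite setT mup.
    have /sigma_finiteP[F [TF ndF Foo]] := sigma_finiteT l.
    have /sigma_finiteP[G [TG ndG Goo]] := sigma_finiteT mu.
    exists (fun k => F k `*` G k); last first.
      move=> k; have [? ?] := Foo k; have [? ?] := Goo k.
      split; first exact: measurableX.
      by rewrite /mup/= product_measure1E// lte_mul_pinfty// ge0_fin_numE.
    rewrite -setXTT TF TG predeqE => -[x y]; split; last first.
      by move=> [k _ []/= ? ?]; split; exists k.
    move=> [/= [i _ Fix] [k _ Gky]]; exists (maxn i k) => //; split.
      by move: x Fix; exact/subsetPset/ndF/leq_maxl.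
    by move: y Gky; exact/subsetPset/ndG/leq_maxr.
  exists (fun k => @uncons_rV n @^-1` F k).
    by rewrite -preimage_bigcup -FT preimage_setT.
  move=> k; have [mF mFoo] := Ffin k; split.
    by rewrite -[X in measurable X]setTI; exact: measurable_uncons_rV.
  rewrite /m /pushforward -comp_preimage (_ : _ \o _ = id) ?preimage_id//.
  by apply/funext => x /=; rewrite uncons_rVK.
pose M : {sigma_finite_measure set _ -> \bar R} :=
  HB.pack m (Measure_isSigmaFinite.Build _ _ _ m sm).
have mc := @measurable_cons_rV n.
by exists (M mc mc mc); rewrite /= IH.
Qed.

Let borel_lebesgue0 n : borel_lebesgue (set0 : set 'rV[R]_n) = 0%E.
Proof. by have [mu ->] := borel_lebesgue_is_measure n; rewrite measure0. Qed.

Let borel_lebesgue_ge0 n (A : set 'rV[R]_n) : (0 <= borel_lebesgue A)%E.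
Proof. by have [mu ->] := borel_lebesgue_is_measure n; exact: measure_ge0. Qed.

Let borel_lebesgue_semi_sigma_additive n :
  semi_sigma_additive (@borel_lebesgue R n).
Proof.
have [mu ->] := borel_lebesgue_is_measure n.
exact: measure_semi_sigma_additive.
Qed.

HB.instance Definition _ n := isMeasure.Build _ _ _ (@borel_lebesgue R n)
  (@borel_lebesgue0 n) (@borel_lebesgue_ge0 n)
  (@borel_lebesgue_semi_sigma_additive n).

Let borel_lebesgue_sigma_finite n : sigma_finite setT (@borel_lebesgue R n).
Proof.
by have [mu ->] := borel_lebesgue_is_measure n; exact: sigma_finiteT.
Qed.

HB.instance Definition _ n := Measure_isSigmaFinite.Build _ _ _
  (@borel_lebesgue R n) (@borel_lebesgue_sigma_finite n).

Lemma borel_lebesgue_box n (a b : 'rV[R]_n) : (forall i, a 0 i <= b 0 i) ->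
  borel_lebesgue [set x : 'rV[R]_n | forall i, a 0 i <= x 0 i <= b 0 i] =
  (\prod_(i < n) (b 0 i - a 0 i))%:E.
Proof.
elim: n a b => [|n IH] a b ab.
  by rewrite big_ord0 /= diracE mem_set//= => -[].
pose tl (c : 'rV[R]_n.+1) : 'rV[R]_n := \row_j c 0 (lift ord0 j).
rewrite /= /pushforward.
rewrite (_ : _ @^-1` _ = `[a 0 ord0, b 0 ord0]%classic `*`
  [set x : 'rV[R]_n | forall i, tl a 0 i <= x 0 i <= tl b 0 i]); last first.
  apply/seteqP; split => -[x y] /=.
    move=> h; split => [|i /=].
      by rewrite in_itv /=; have := h ord0; rewrite cons_rV0.
    by have := h (lift ord0 i); rewrite cons_rVS !mxE.
  rewrite in_itv /= => -[h1 h2] i; case: (unliftP ord0 i) => [j|] ->.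
    by rewrite cons_rVS; have := h2 j; rewrite !mxE.
  by rewrite cons_rV0.
rewrite product_measure1E//; last exact: measurable_box_rV.
rewrite /= IH => [|i]; last by rewrite !mxE.
rewrite lebesgue_measure_itv /= lte_fin big_ord_recl EFinM.
have -> : \prod_(i < n) (tl b 0 i - tl a 0 i) =
    \prod_(i < n) (b 0 (lift ord0 i) - a 0 (lift ord0 i)).
  by apply: eq_bigr => i _; rewrite !mxE.
case: ltP => // ba; congr *%E; congr EFin; apply/eqP.
by rewrite eq_sym subr_eq0 eq_le ba ab.
Qed.

End borel_lebesgue_measure.

(* As for completed_lebesgue_measure in dimension one: the completion is the
   outer measure induced by the product measure on the Borel sets, and a set is
   Lebesgue measurable when it satisfies Caratheodory's criterion for it.     *)
Definition lebesgue_rV {R : realType} {n : nat} : set 'rV[R]_n -> \bar R :=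
  @completed_measure_extension _ 'rV[R]_n R (@borel_lebesgue R n).

Definition lebesgue_measurable {R : realType} {n : nat} (A : set 'rV[R]_n) :=
  ((@borel_lebesgue R n)^*)%mu.-cara.-measurable A.

Lemma lebesgue_rV_box (R : realType) n (a b : 'rV[R]_n) :
  (forall i, a 0 i <= b 0 i) ->
  lebesgue_rV [set x : 'rV[R]_n | forall i, a 0 i <= x 0 i <= b 0 i] =
  (\prod_(i < n) (b 0 i - a 0 i))%:E.
Proof.
move=> ab; rewrite -borel_lebesgue_box//.
apply: (measurable_mu_extE (@borel_lebesgue R n)).
exact: measurable_box_rV.
Qed.

Section upper_density.
Context {R : realType} {n : nat}.
Implicit Types (A : set 'rV[R]_n) (x : 'rV[R]_n).

Definition cube x (r : R) : set 'rV[R]_n :=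
  [set y | forall i, x 0 i <= y 0 i <= x 0 i + r].

Definition upper_banach_density A : \bar R :=
  limf_esup (fun r : R => ereal_sup
    [set (lebesgue_rV (A `&` cube x r) * ((r ^+ n)^-1)%:E)%E
       | x in [set: 'rV[R]_n]])
    (pinfty_nbhs R).

End upper_density.

Definition measurable_coloring {R : realType} {n k : nat}
    (C : 'I_k -> set 'rV[R]_n) :=
  partition [set: 'I_k] C [set: 'rV[R]_n] /\
  forall c, lebesgue_measurable (C c).

Section boxes.
Context {R : realType} {m n : nat}.
Implicit Types (p : 'rV[R]_n) (v : 'I_m -> 'rV[R]_n).

Definition dotv (u w : 'rV[R]_n) : R := \sum_i u 0 i * w 0 i.

(* The library norm on row vectors is the maximum norm. *)
Definition enorm (u : 'rV[R]_n) : R := Num.sqrt (dotv u u).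

Definition box_edges v :=
  (forall j, v j != 0) /\ (forall i j, i != j -> dotv (v i) (v j) = 0).

Definition box_vertex p v (T : {set 'I_m}) : 'rV[R]_n := p + \sum_(j in T) v j.

Definition box_volume v : R := \prod_j enorm (v j).

(* Indices start at 0, so that the last edge is v_(m-1) and the coordinate
   vectors not used by the other edges are those of index at least m - 1.    *)
Definition edges_aligned v :=
  (forall (j : 'I_m) (i : 'I_n), (j < m.-1)%N -> i = j :> nat ->
     exists c : R, v j = c *: delta_mx 0 i) /\
  (forall j : 'I_m, j = m.-1 :> nat ->
     (v j <= \sum_(i < n | (m.-1 <= i)%N) <<delta_mx 0 i : 'rV[R]_n>>)%MS).

End boxes.

(* Main.v *)
Require Import Defs.
From mathcomp Require Import all_boot all_order all_algebra.
From mathcomp Require Import all_classical all_reals all_analysis.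
From mathcomp Require Import measurable_realfun ring lra.
Import Order.TTheory GRing.Theory Num.Theory.
Import numFieldNormedType.Exports.
Local Open Scope classical_set_scope.
Local Open Scope ring_scope.

Set Implicit Arguments.
Unset Strict Implicit.
Unset Printing Implicit Defensive.

(* The heart of the matter is the plane: a set A of positive density contains
   two points at distance lam, for some lam in any given unbounded set.  Choose
   scales l_0 << lam_0 << l_1 << lam_1 << ... ; by an energy pigeonhole there is
   j such that on a vertical interval of length H = l_(j+1) and for many
   abscissae x in a window of width lam/2 (lam = lam_j) the column A_x is dense,
   and its averages over the cells of length h = l_j are nearly constant.
   Choose N well separated columns x_i among these.  If A has no distance lam,
   then y + sqrt (lam^2 - (x - x_i)^2) never belongs to A_(x_i) when (x, y) is
   in A, so that the deviations of the indicators of the A_(x_i) from their cell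
   averages, shifted by these square roots, add up to a function of y with a
   large L^2 norm, for each good x.  But for distinct i the deviations are
   nearly orthogonal on average over x: the difference of two of the square
   roots has a derivative bounded below, and thus equidistributes x in the cells.
   Slicing gives (m, n) = (1, n) from the plane, and (m + 1, n + 1) from (m, n):
   some slice meets, with positive density, its translate by an integer a <= K
   along the first axis, and contains with it a box of volume V / a. *)

(** The theorem is proved through its negation: if it failed for [A], the volumes that are not
    realised would form an unbounded set [VV], so it suffices to realise one element of every
    unbounded [VV]. The side [R0] from which this works must depend only on the density [d] and on
    [VV]: the Borel subset of [A] in use changes with the cube, and the induction on [m] invokes the
    previous case for the finitely many sets [VV / a] before the shift [a] is known. Elements of
    [VV] cannot be prescribed, only taken far out; so the scales are interleaved with them and fixed
    in advance, and the pigeonhole selects one among boundedly many. Many columns are needed because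
    one column gives no contradiction: the energy that avoidance forces there is below the trivial
    bound. With [N] columns the forced energy grows like [N ^+ 2], the diagonal correlations only
    like [N], and each off-diagonal one is smaller than a diagonal one by a factor of order
    [h / lam]. Slicing takes place within Borel sets, for which the measure is an iterated integral
    by construction; Lebesgue measurable sets enter only at the end, by inner approximation. *)

(** * Integration of bounded functions with support of finite measure *)

(** Unlike integrability, this property is stable under products as well as linear operations, so
    the integrability of the integrands below follows from their shape. *)
Definition bfun d (T : measurableType d) (R : realType)
    (mu : {measure set T -> \bar R}) (f : T -> R) :=
  measurable_fun [set: T] f /\ exists (M : R) (E : set T),
    [/\ measurable E, (mu E < +oo)%E, forall x, `|f x| <= M &
        forall x, ~ E x -> f x = 0].

Section BoundedFunctions.
Context d (T : measurableType d) (R : realType) (mu : {measure set T -> \bar R}).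
Implicit Types f g : T -> R.

Lemma bfun_indic (E : set T) : measurable E -> (mu E < +oo)%E -> bfun mu (\1_E).
Proof.
move=> mE Eoo; split; first exact: measurable_indic.
exists 1, E; split => // x; first by rewrite indicE; case: (x \in E); rewrite /= ?normr1 ?normr0.
by move=> nE; rewrite indicE memNset.
Qed.

Lemma bfunD f g : bfun mu f -> bfun mu g -> bfun mu (fun x => f x + g x).
Proof.
move=> [mf [M [E [mE Eoo fM fE]]]] [mg [M' [E' [mE' E'oo gM gE]]]]; split.
  exact: measurable_funD.
exists (M + M'), (E `|` E'); split.
- exact: measurableU.
- by apply: le_lt_trans (measureU2 _ _ _) _ => //; rewrite lte_add_pinfty.
- by move=> x; apply: le_trans (ler_normD _ _) _; exact: lerD.
- by move=> x /= /not_orP[h1 h2]; rewrite fE// gE// addr0.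
Qed.

Lemma bfunM f g : bfun mu f -> bfun mu g -> bfun mu (fun x => f x * g x).
Proof.
move=> [mf [M [E [mE Eoo fM fE]]]] [mg [M' [E' [mE' E'oo gM gE]]]]; split.
  exact: measurable_funM.
exists (M * M'), E; split => //.
- by move=> x; rewrite normrM; exact: ler_pM.
- by move=> x nE; rewrite fE// mul0r.
Qed.

Lemma bfunZ c f : bfun mu f -> bfun mu (fun x => c * f x).
Proof.
move=> [mf [M [E [mE Eoo fM fE]]]]; split; first exact: measurable_funM.
exists (`|c| * M), E; split => //.
- by move=> x; rewrite normrM; exact: ler_wpM2l.
- by move=> x nE; rewrite fE// mulr0.
Qed.

Lemma bfunB f g : bfun mu f -> bfun mu g -> bfun mu (fun x => f x - g x).
Proof.
move=> bf bg; rewrite (_ : (fun _ => _) = fun x => f x + (-1) * g x).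
  by apply: bfunD => //; exact: bfunZ.
by apply/funext => x; rewrite mulN1r.
Qed.

Lemma bfun_norm f : bfun mu f -> bfun mu (fun x => `|f x|).
Proof.
move=> [mf [M [E [mE Eoo fM fE]]]]; split; first exact: measurableT_comp.
exists M, E; split => //; first by move=> x; rewrite normr_id.
by move=> x nE; rewrite fE// normr0.
Qed.

Lemma bfun0 : bfun mu (fun=> 0).
Proof.
split => //; exists 0, set0; split => //; first by rewrite measure0.
by move=> x; rewrite normr0.
Qed.

Lemma bfun_sum I (r : seq I) (P : pred I) (F : I -> T -> R) :
  (forall i, bfun mu (F i)) -> bfun mu (fun x => \sum_(i <- r | P i) F i x).
Proof.
move=> bF; elim: r => [|i r IH].
  by under eq_fun do rewrite big_nil; exact: bfun0.
under eq_fun do rewrite big_cons.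
by case: (P i) => //; exact: bfunD.
Qed.

Lemma bfun_integrable f : bfun mu f -> mu.-integrable setT (EFin \o f).
Proof.
move=> [mf [M [E [mE Eoo fM fE]]]].
have M0 (x : T) : 0 <= M by apply: le_trans (fM x).
have i1 : mu.-integrable E (cst M%:E).
  apply/integrableP; split => //=; rewrite integral_cst//.
  by rewrite lte_mul_pinfty.
have i2 : mu.-integrable setT ((cst M%:E) \_ E).
  exact: ((integrable_mkcond (cst M%:E) mE).1 i1).
apply: (le_integrable _ _ _ i2) => //; first exact/measurable_EFinP.
move=> x _; rewrite /= patchE; case: ifPn => xE.
  by rewrite lee_fin (le_trans (fM x))// ler_norm.
by rewrite fE ?normr0 ?lee_fin ?normr0 //; rewrite -notin_setE.
Qed.

Lemma intD f g : bfun mu f -> bfun mu g ->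
  \int[mu]_x (f x + g x) = \int[mu]_x f x + \int[mu]_x g x.
Proof. by move=> bf bg; rewrite RintegralD//; exact: bfun_integrable. Qed.

Lemma intB f g : bfun mu f -> bfun mu g ->
  \int[mu]_x (f x - g x) = \int[mu]_x f x - \int[mu]_x g x.
Proof. by move=> bf bg; rewrite RintegralB//; exact: bfun_integrable. Qed.

Lemma intZ c f : bfun mu f -> \int[mu]_x (c * f x) = c * \int[mu]_x f x.
Proof. by move=> bf; rewrite RintegralZl//; exact: bfun_integrable. Qed.

Lemma int0 : \int[mu]_x (0 : R) = 0.
Proof. by rewrite /Rintegral integral0. Qed.

Lemma int_sum I (r : seq I) (P : pred I) (F : I -> T -> R) :
  (forall i, bfun mu (F i)) ->
  \int[mu]_x (\sum_(i <- r | P i) F i x) = \sum_(i <- r | P i) \int[mu]_x F i x.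
Proof.
move=> bF; elim: r => [|i r IH].
  by rewrite big_nil -[RHS]int0; apply: eq_Rintegral => x _; rewrite big_nil.
rewrite big_cons; transitivity (\int[mu]_x
  ((if P i then F i x else 0) + \sum_(i <- r | P i) F i x)).
  by apply: eq_Rintegral => x _; rewrite big_cons; case: ifP; rewrite ?add0r.
case: ifP => _; rewrite intD ?IH ?int0 ?add0r//; try exact: bfun_sum.
exact: bfun0.
Qed.

Lemma le_int f g : bfun mu f -> bfun mu g -> (forall x, f x <= g x) ->
  \int[mu]_x f x <= \int[mu]_x g x.
Proof.
by move=> bf bg fg; apply: le_Rintegral => //; exact: bfun_integrable.
Qed.

Lemma int_indic (E : set T) : measurable E -> \int[mu]_x \1_E x = fine (mu E).
Proof. by move=> mE; rewrite /Rintegral integral_indic// setIT. Qed.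

End BoundedFunctions.

(** * Expanding maps and Lebesgue measure on the line *)

Section Expanding.
Context (R : realType).
Local Notation mu := (@lebesgue_measure R).

(** The set lies in the interval of length [r] that starts at [inf E]. *)
Lemma measure_le_diam (E : set R) (r : R) : measurable E -> 0 <= r ->
  (forall x y, E x -> E y -> y - x <= r) -> (mu E <= r%:E)%E.
Proof.
move=> mE r0 dE; have [->|/set0P [x0 Ex0]] := eqVneq E set0.
  by rewrite measure0 lee_fin.
have hlb : has_inf E.
  split; first by exists x0.
  by exists (x0 - r) => y Ey; have := dE _ _ Ey Ex0; lra.
have sub : E `<=` `[inf E, inf E + r]%classic.
  move=> y Ey; rewrite /= in_itv /=; apply/andP; split.
    by apply: ge_inf => //; case: hlb.
  rewrite -lerBlDr; apply: lb_le_inf; first by exists x0.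
  by move=> z Ez; have := dE _ _ Ez Ey; lra.
apply: (@le_trans _ _ (mu `[inf E, inf E + r]%classic)).
  by apply: le_measure => //; rewrite inE.
rewrite lebesgue_measure_itv /= lte_fin; case: ifP => _; last by rewrite lee_fin.
by rewrite -EFinD lee_fin; lra.
Qed.

(** The measure of [S] is an infimum over countable covers by half-open intervals, and the part of
    [P] that [b] sends into an interval of length [L] has diameter at most [L / beta]. *)
Lemma lebesgue_measure_expanding (P S : set R) (b : R -> R) (beta : R) :
  measurable P -> measurable S -> measurable_fun setT b -> 0 < beta ->
  (forall x y, P x -> P y -> x <= y -> beta * (y - x) <= b y - b x) ->
  (beta%:E * mu (P `&` b @^-1` S) <= mu S)%E.
Proof.
move=> mP mS mb b0 eb.
have mpre A : measurable A -> measurable (P `&` b @^-1` A).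
  by move=> mA; apply: measurableI => //; rewrite -[X in measurable X]setTI; exact: mb.
apply: le_ereal_inf_tmp => _ [F [mF SF] <-].
have mF' k : measurable (F k : set R).
  by have [[u v] _ <-] := mF k.
apply: (@le_trans _ _ (beta%:E * \sum_(k <oo) mu (P `&` b @^-1` F k))%E).
  apply: lee_wpmul2l; first by rewrite lee_fin ltW.
  apply: measure_sigma_subadditive => //; first by move=> k; exact: mpre.
    exact: mpre.
  by move=> x [Px /= /SF [k _ Fk]]; exists k.
rewrite -nneseriesZl//.
apply: lee_nneseries => //.
  by move=> k _ _; rewrite mule_ge0// lee_fin ltW.
move=> k _; have [[u v] _ <-] := mF k.
rewrite -[leRHS]/(wlength idfun `]u, v]%classic).
rewrite wlength_itv /= lte_fin; case: ifPn => uv; last first.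
  rewrite set_itv_ge; last by rewrite bnd_simp.
  by rewrite preimage_set0 setI0 measure0 mule0.
have : (mu (P `&` b @^-1` `]u, v]%classic) <= ((v - u) / beta)%:E)%E.
  apply: measure_le_diam; first by apply: mpre; exact: measurable_itv.
    by apply: divr_ge0; rewrite ?subr_ge0 ltW.
  move=> x y [Px /=]; rewrite in_itv /= => /andP[ux xv].
  move=> [Py /=]; rewrite in_itv /= => /andP[uy yv].
  have [xy|yx] := leP x y; last first.
    by apply: (@le_trans _ _ 0); [lra|apply: divr_ge0; rewrite ?subr_ge0 ltW].
  by rewrite ler_pdivlMr// mulrC; have := eb _ _ Px Py xy; lra.
move=> /(lee_wpmul2l (ltW b0 : (0%E <= beta%:E)%E)) /le_trans; apply.
by rewrite -EFinM lee_fin mulrC divfK ?gt_eqF.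
Qed.

(** A translation and its inverse are both expanding with constant 1, which gives the two
    inequalities. *)
Lemma lebesgue_measure_shift (S : set R) (c : R) : measurable S ->
  mu ((fun x : R => (x + c)%R) @^-1` S) = mu S.
Proof.
have H (A : set R) (a : R) : measurable A -> (mu ((fun x : R => (x + a)%R) @^-1` A) <= mu A)%E.
  move=> mA; have := @lebesgue_measure_expanding setT A (fun x : R => x + a) 1.
  rewrite setTI mul1e; apply => //; first exact: measurable_funD.
  by move=> x y _ _ _; lra.
move=> mS; apply/eqP; rewrite eq_le H//=.
have mS' : measurable ((fun x : R => (x + c)%R) @^-1` S).
  rewrite -[X in measurable X]setTI.
  by apply: measurable_funD => //.
apply: le_trans (H _ (- c) mS'); rewrite le_eqVlt; apply/orP; left; apply/eqP.
by congr (mu _); apply/seteqP; split => x /=; rewrite subrK.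
Qed.

End Expanding.


Lemma EFin_int d (T : measurableType d) (R : realType)
    (mu : {measure set T -> \bar R}) (f : T -> R) : bfun mu f ->
  (\int[mu]_x f x)%:E = (\int[mu]_x (f x)%:E)%E.
Proof.
move=> bf; rewrite /Rintegral fineK//.
exact: integrable_fin_num (bfun_integrable bf).
Qed.

Lemma normr_int_le d (T : measurableType d) (R : realType)
    (mu : {measure set T -> \bar R}) (f : T -> R) (M : R) (E : set T) :
  measurable_fun setT f -> measurable E -> (mu E < +oo)%E ->
  (forall x, `|f x| <= M) -> (forall x, ~ E x -> f x = 0) ->
  `|\int[mu]_x f x| <= M * fine (mu E).
Proof.
move=> mf mE Eoo fM fE.
have bf : bfun mu f by split => //; exists M, E.
have bI : bfun mu (\1_E : T -> R) by exact: bfun_indic.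
apply: le_trans (le_normr_Rintegral _ (bfun_integrable bf)) _ => //.
rewrite -int_indic// -intZ//; apply: le_int.
- exact: bfun_norm.
- exact: bfunZ.
move=> x; rewrite indicE; case: (boolP (x \in E)) => xE; first by rewrite mulr1.
by rewrite mulr0 fE ?normr0//; rewrite -notin_setE.
Qed.

(** * Translation invariance and Fubini for real-valued integrals *)

Section LebesgueInt.
Context (R : realType).
Local Notation mu := (@lebesgue_measure R).

Lemma bfun_shift (f : R -> R) c : bfun mu f -> bfun mu (fun y => f (y + c)).
Proof.
move=> [mf [M [E [mE Eoo fM fE]]]]; split.
  by apply: measurableT_comp => //; exact: measurable_funD.
exists M, ((fun y : R => (y + c)%R) @^-1` E); split => //.
- rewrite -[X in measurable X]setTI; apply: measurable_funD => //.
- apply: le_lt_trans Eoo; rewrite le_eqVlt; apply/orP; left; apply/eqP.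
  exact: lebesgue_measure_shift.
- by move=> x /= nE; exact: fE.
Qed.

Lemma int_shift (f : R -> R) c : bfun mu f ->
  \int[mu]_y f (y + c) = \int[mu]_y f y.
Proof.
move=> bf; apply: EFin_inj; rewrite !EFin_int//; last exact: bfun_shift.
pose phi : measurableTypeR R -> measurableTypeR R := fun y : R => (y + c)%R.
have mphi : measurable_fun setT phi by exact: measurable_funD.
have -> : (\int[mu]_y (f (y + c)%R)%:E = \int[pushforward mu phi]_y (f y)%:E)%E.
  rewrite integral_pushforward//.
    by apply/measurable_EFinP; case: bf.
  rewrite preimage_setT.
  exact: (bfun_integrable (bfun_shift c bf)).
apply: eq_measure_integral => A mA _; rewrite /pushforward.
exact: lebesgue_measure_shift.
Qed.

(** A support inside a rectangle of finite measure makes both partial integrals bounded functions of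
    the same class, so the calculus of [bfun] continues to apply to them. *)
Lemma fubini_swap (F : R * R -> R) (M : R) (E1 E2 : set R) :
  measurable_fun setT F ->
  measurable E1 -> (mu E1 < +oo)%E -> measurable E2 -> (mu E2 < +oo)%E ->
  (forall z, `|F z| <= M) ->
  (forall x y, ~ E1 x -> F (x, y) = 0) -> (forall x y, ~ E2 y -> F (x, y) = 0) ->
  [/\ bfun mu (fun x => \int[mu]_y F (x, y)),
      bfun mu (fun y => \int[mu]_x F (x, y)) &
      \int[mu]_x \int[mu]_y F (x, y) = \int[mu]_y \int[mu]_x F (x, y)].
Proof.
move=> mF mE1 E1oo mE2 E2oo FM F1 F2.
have m1 x : measurable_fun setT (fun y => F (x, y)).
  by apply: measurableT_comp => //; exact: measurable_pair1.
have m2 y : measurable_fun setT (fun x => F (x, y)).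
  by apply: measurableT_comp => //; exact: measurable_pair2.
have b1 x : bfun mu (fun y => F (x, y)).
  by split; [exact: m1|]; exists M, E2; split => // y; exact: F2.
have b2 y : bfun mu (fun x => F (x, y)).
  by split; [exact: m2|]; exists M, E1; split => // x; exact: F1.
have bF : bfun (mu \x mu)%E F.
  split => //; exists M, (E1 `*` E2); split => //.
  - exact: measurableX.
  - apply: (@le_lt_trans _ _ (mu E1 * mu E2)%E).
      by rewrite le_eqVlt; apply/orP; left; apply/eqP; exact: product_measure1E.
    by rewrite lte_mul_pinfty// ge0_fin_numE.
  - by move=> [x y] /= /not_andP[]; [exact: F1|exact: F2].
have iF := bfun_integrable bF.
have B1 : bfun mu (fun x => \int[mu]_y F (x, y)).
  split.
    apply/measurable_EFinP; apply: eq_measurable_fun (measurable_fubini_F iF).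
    by move=> x _; rewrite /fubini_F /= EFin_int.
  exists (M * fine (mu E2)), E1; split => //.
    by move=> x; apply: (@normr_int_le _ (measurableTypeR R) _ mu _ M E2 (m1 x)) => // y; exact: F2.
  by move=> x nE; rewrite -[RHS](int0 mu); apply: eq_Rintegral => y _; exact: F1.
have B2 : bfun mu (fun y => \int[mu]_x F (x, y)).
  split.
    apply/measurable_EFinP; apply: eq_measurable_fun (measurable_fubini_G iF).
    by move=> x _; rewrite /fubini_G /= EFin_int.
  exists (M * fine (mu E1)), E2; split => //.
    by move=> y; apply: (@normr_int_le _ (measurableTypeR R) _ mu _ M E1 (m2 y)) => // x; exact: F1.
  by move=> y nE; rewrite -[RHS](int0 mu); apply: eq_Rintegral => x _; exact: F2.
split => //; apply: EFin_inj; rewrite !EFin_int//.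
under eq_integral => x _ do rewrite EFin_int//.
under [RHS]eq_integral => x _ do rewrite EFin_int//.
exact: (@Fubini _ _ _ _ _ mu mu _ iF).
Qed.

End LebesgueInt.


(** * Cells, oscillations, and their averages along an expanding map *)

Section Cells.
Context (R : realType).
Local Notation mu := (@lebesgue_measure R).

(** A set of infinite measure gets length 0, hence the finiteness hypotheses below. *)
Definition length (E : set R) : R := fine (mu E).

Lemma length_ge0 E : 0 <= length E.
Proof. exact: fine_ge0. Qed.

Lemma measure_itvco_lty (a b : R) : (mu `[a, b[%classic < +oo)%E.
Proof. by rewrite lebesgue_measure_itv /=; case: ifP => _; rewrite ltry. Qed.

Lemma sub_lty (E F : set R) : measurable E -> measurable F -> E `<=` F ->
  (mu F < +oo)%E -> (mu E < +oo)%E.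
Proof.
by move=> mE mF EF; apply: le_lt_trans; apply: le_measure => //; rewrite inE.
Qed.

Lemma length_le (E F : set R) : measurable E -> measurable F -> E `<=` F ->
  (mu F < +oo)%E -> length E <= length F.
Proof.
move=> mE mF EF Foo; apply: fine_le.
- by rewrite ge0_fin_numE//; exact: sub_lty EF Foo.
- by rewrite ge0_fin_numE.
- by apply: le_measure => //; rewrite inE.
Qed.

Lemma EFin_length (E : set R) : (mu E < +oo)%E -> (length E)%:E = mu E.
Proof. by move=> Eoo; rewrite /length fineK// ge0_fin_numE. Qed.

Lemma lengthD (E F : set R) : measurable E -> measurable F -> F `<=` E ->
  (mu E < +oo)%E -> length (E `\` F) = length E - length F.
Proof.
move=> mE mF FE Eoo; have Foo := sub_lty mF mE FE Eoo.
rewrite /length measureD//.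
rewrite (setIidr FE) fineB// ge0_fin_numE//.
Qed.

Lemma length_itvco (a b : R) : a <= b -> length `[a, b[%classic = b - a.
Proof.
move=> ab; rewrite /length lebesgue_measure_itv /= lte_fin.
by case: ltP => //= ba; apply/eqP; rewrite eq_sym subr_eq0 eq_le ba ab.
Qed.

(** Half-open, so that consecutive cells tile an interval exactly, and a cell of length [q * h] is a
    disjoint union of [q] cells of length [h]. *)
Definition cell (Y h : R) (k : nat) : set R :=
  `[Y + k%:R * h, Y + k.+1%:R * h[%classic.

Lemma measurable_cell Y h k : measurable (cell Y h k).
Proof. exact: measurable_itv. Qed.
#[local] Hint Resolve measurable_cell : core.

Lemma cell_lty Y h k : (mu (cell Y h k) < +oo)%E.
Proof. exact: measure_itvco_lty. Qed.
#[local] Hint Resolve cell_lty : core.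

Lemma length_cell Y h k : 0 <= h -> length (cell Y h k) = h.
Proof.
move=> h0; rewrite length_itvco; first by rewrite -natr1; ring.
by rewrite lerD2l ler_wpM2r// ler_nat.
Qed.

Lemma sum_cell Y h n u : 0 <= h ->
  \sum_(k < n) (\1_(cell Y h k) u : R) = \1_(`[Y, Y + n%:R * h[%classic) u.
Proof.
move=> h0; elim: n => [|n IH].
  by rewrite big_ord0 mul0r addr0 set_itv_ge ?bnd_simp ?ltxx// indic0.
rewrite big_ord_recr /= {}IH !indicE /cell -natr1 mulrDl mul1r addrA.
set v := Y + n%:R * h.
have Yv : Y <= v by rewrite lerDl mulr_ge0.
rewrite !mem_setE !in_itv /=.
case: (leP Y u) => Yu /=; last first.
  by rewrite leNgt (lt_le_trans Yu Yv)/= addr0.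
case: (ltP u v) => uv /=; last by rewrite add0r.
by rewrite addr0 (lt_le_trans uv)// lerDl.
Qed.

Definition ratio (S : set R) Y h k : R := length (S `&` cell Y h k) / h.

Lemma ratio_ge0 S Y h k : 0 <= h -> 0 <= ratio S Y h k.
Proof. by move=> h0; rewrite divr_ge0// length_ge0. Qed.

Lemma ratio_le1 S Y h k : measurable S -> 0 < h -> ratio S Y h k <= 1.
Proof.
move=> mS h0; rewrite ler_pdivrMr// mul1r; apply: (@le_trans _ _ (length (cell Y h k))).
  by apply: length_le => //; exact: measurableI.
by rewrite length_cell// ltW.
Qed.

(** The indicator of [S] minus its conditional expectation on the cells: it has mean zero on each of
    the [n] cells and vanishes outside them. *)
Definition osc (S : set R) Y h n u : R :=
  \sum_(k < n) (\1_(S `&` cell Y h k) u - ratio S Y h k * \1_(cell Y h k) u).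

Section Equi.
Variables (S : set R) (Y h : R) (n : nat) (a w : R) (b : R -> R) (beta K : R).
Hypotheses (mS : measurable S) (h0 : 0 < h) (w0 : 0 <= w).
Hypotheses (mb : measurable_fun setT b) (beta0 : 0 < beta) (K0 : 0 <= K).
Hypothesis expand : forall x y : R, a <= x -> x <= y -> y <= a + w ->
  beta * (y - x) <= b y - b x.
(** The mean slope of [b] on an interval exceeds that on a subinterval by at most [K] times the
    length of the larger one. Denominators are cleared, so that degenerate intervals are allowed. *)
Hypothesis equi : forall p x y p' : R, a <= p -> p <= x -> x <= y -> y <= p' ->
  p' <= a + w ->
  (b p' - b p) * (y - x) <= ((b y - b x) + K * (p' - p) * (y - x)) * (p' - p).
Hypothesis onto : forall v : R, b a <= v <= b (a + w) ->
  exists x : R, a <= x <= a + w /\ b x = v.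

Let W := `[a, a + w[%classic.
Let pre (E : set R) := W `&` b @^-1` E.

Let mpre E : measurable E -> measurable (pre E).
Proof.
move=> mE; apply: measurableI; first exact: measurable_itv.
by rewrite -[X in measurable X]setTI; exact: mb.
Qed.

Let Woo : (mu W < +oo)%E. Proof. exact: measure_itvco_lty. Qed.

Let preoo E : measurable E -> (mu (pre E) < +oo)%E.
Proof.
move=> mE; apply: sub_lty Woo; [exact: mpre|exact: measurable_itv|].
exact: subIsetl.
Qed.

Let mono x y : a <= x -> x <= y -> y <= a + w -> b x <= b y.
Proof.
move=> ax xy yw; have := expand ax xy yw.
have : 0 <= beta * (y - x) by rewrite mulr_ge0 ?subr_ge0// ltW.
lra.
Qed.

Let expandE P E (sigma : R) : P `<=` W -> measurable P -> measurable E ->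
  (mu E < +oo)%E ->
  (forall x y, P x -> P y -> x <= y -> sigma * (y - x) <= b y - b x) ->
  sigma * length (P `&` b @^-1` E) <= length E.
Proof.
move=> PW mP mE Eoo sP.
(* The slope bound [h / (p' - p) - K * (p' - p)] substituted later for [sigma] may fail to be
   positive; the claim is then trivial. *)
have [s0|s0] := ltP 0 sigma; last first.
  by apply: (le_trans _ (length_ge0 E)); rewrite mulr_le0_ge0// length_ge0.
have := lebesgue_measure_expanding mP mE mb s0 sP.
have m1 : measurable (P `&` b @^-1` E).
  by apply: measurableI => //; rewrite -[X in measurable X]setTI; exact: mb.
have oo1 : (mu (P `&` b @^-1` E) < +oo)%E.
  apply: sub_lty Woo => //; first exact: measurable_itv.
  by move=> x [Px _]; exact: PW.
by rewrite -(EFin_length oo1) -(EFin_length Eoo) -EFinM lee_fin.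
Qed.

Let len_preE E : measurable E -> (mu E < +oo)%E ->
  beta * length (pre E) <= length E.
Proof.
move=> mE Eoo; apply: expandE => //; first exact: measurable_itv.
move=> x y; rewrite /W /= !in_itv /= => /andP[ax _] /andP[_ yw] xy.
by apply: expand => //; exact: ltW.
Qed.

Let length_pre_cell k : beta * length (pre (cell Y h k)) <= h.
Proof.
apply: (le_trans (len_preE (@measurable_cell Y h k) (@cell_lty Y h k))).
by rewrite length_cell// ltW.
Qed.

(** Here [rho] is the length of the preimage of a cell, [s] the measure of a subset of that cell and
    [m] that of its preimage. The slope bound gives [h * m <= s * rho + K * rho ^+ 2 * m], and the
    last term is absorbed using [beta * rho <= h] and [beta * m <= h]. *)
Let arith rho s m : 0 < rho -> beta * rho <= h -> 0 <= s <= h -> 0 <= m ->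
  beta * m <= s -> (h / rho - K * rho) * m <= s ->
  m <= s * rho / h + h * K * rho / beta ^+ 2.
Proof.
move=> r0 br /andP[s0 sh] m0 bm H.
rewrite -(ler_pM2l h0) mulrDr (mulrC h (s * rho / h)) divfK ?gt_eqF//.
have hp := h0.
have H1 : h * m <= s * rho + K * rho ^+ 2 * m.
  have := ler_wpM2r (ltW r0) H; rewrite mulrAC mulrBl divfK ?gt_eqF//.
  rewrite mulrBl; lra.
have H2 : K * rho ^+ 2 * m <= h * (h * K * rho / beta ^+ 2).
  rewrite mulrA ler_pdivlMr ?exprn_gt0//.
  have : (beta * rho) * (beta * m) <= h * h.
    by apply: ler_pM; rewrite ?mulr_ge0 ?(ltW beta0) ?(ltW r0) ?(le_trans bm).
  have kr : 0 <= K * rho by rewrite mulr_ge0// ltW.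
  move=> /(ler_wpM2l kr).
  by rewrite !expr2; lra.
lra.
Qed.

(* Expansion bounds the measure of the preimage of a set from above only; the
   lower bound comes from the complement within the cell. *)
Let full_cell k : b a <= Y + k%:R * h -> Y + k.+1%:R * h <= b (a + w) ->
  `|length (pre (S `&` cell Y h k)) - ratio S Y h k * length (pre (cell Y h k))|
    <= h * K * length (pre (cell Y h k)) / beta ^+ 2.
Proof.
have hp := h0; have wp := w0.
have [u Eu] : exists u, u = Y + k%:R * h by exists (Y + k%:R * h).
have Ev : Y + k.+1%:R * h = u + h by rewrite Eu -natr1; ring.
rewrite -Eu Ev => bk kb.
have [p [/andP[ap pw] bp]] : exists x : R, a <= x <= a + w /\ b x = u.
  by apply: onto; apply/andP; split; lra.
have [p' [/andP[ap' p'w] bp']] : exists x : R, a <= x <= a + w /\ b x = u + h.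
  by apply: onto; apply/andP; split; lra.
have pp' : p < p'.
  by rewrite ltNge; apply/negP => /(mono ap'); rewrite bp bp' => /(_ pw); lra.
have preE : pre (cell Y h k) = `[p, p'[%classic.
  apply/seteqP; split => x; rewrite /pre /W /cell /= !in_itv /= Ev -Eu.
    move=> [/andP[ax xw] /andP[ux xv]]; apply/andP; split; last first.
      rewrite ltNge; apply/negP => p'x.
      by have := mono ap' p'x (ltW xw); rewrite bp'; lra.
    rewrite leNgt; apply/negP => xp.
    have := expand ax (ltW xp) pw; rewrite bp.
    have : 0 < beta * (p - x) by rewrite mulr_gt0// subr_gt0.
    lra.
  move=> /andP[px xp']; have xw : x < a + w by lra.
  split; first by rewrite xw andbT; lra.
  have := mono ap px (ltW xw); rewrite bp => -> /=.
  have := expand (le_trans ap px) (ltW xp') p'w; rewrite bp'.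
  have : 0 < beta * (p' - x) by rewrite mulr_gt0// subr_gt0.
  lra.
have lpre : length (pre (cell Y h k)) = p' - p.
  by rewrite preE length_itvco// ltW.
have br := length_pre_cell k; rewrite lpre in br.
have r0 : 0 < p' - p by rewrite subr_gt0.
have key E : measurable E -> E `<=` cell Y h k ->
    length (pre E) <= length E * (p' - p) / h + h * K * (p' - p) / beta ^+ 2.
  move=> mE Ec; have Eoo : (mu E < +oo)%E by apply: (sub_lty mE _ Ec).
  apply: arith => //; first 1 last.
  - exact: length_ge0.
  - exact: len_preE.
  - have -> : pre E = `[p, p'[%classic `&` b @^-1` E.
      rewrite -preE /pre -setIA -preimage_setI; congr (_ `&` _ @^-1` _).
      by apply/esym/setIidr.
    apply: expandE => //; first by rewrite -preE; exact: subIsetl.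
    move=> x y; rewrite /= !in_itv /= => /andP[px _] /andP[_ yp'] xy.
    have := equi ap px xy (ltW yp') p'w.
    rewrite bp bp' -ler_pdivrMr// => H; rewrite mulrBl.
    have -> : h / (p' - p) * (y - x) = (u + h - u) * (y - x) / (p' - p).
      by field; rewrite gt_eqF.
    lra.
  rewrite length_ge0 /=; apply: (@le_trans _ _ (length (cell Y h k))).
    exact: length_le.
  by rewrite length_cell// ltW.
rewrite lpre /ratio.
have mSc : measurable (S `&` cell Y h k) by exact: measurableI.
have mcS : measurable (cell Y h k `\` (S `&` cell Y h k)) by exact: measurableD.
have SIc : S `&` cell Y h k `<=` cell Y h k by exact: subIsetr.
have := key _ mcS (@subDsetl _ _ _).
have -> : pre (cell Y h k `\` (S `&` cell Y h k)) =
    pre (cell Y h k) `\` pre (S `&` cell Y h k).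
  apply/seteqP; split => x; rewrite /pre /=.
    by move=> [Wx [cx nSx]]; split => // -[_ Sx]; exact: nSx.
  by move=> [[Wx cx] nS]; split => //; split => // Sx; apply: nS.
rewrite (lengthD (mpre (@measurable_cell Y h k)) (mpre mSc)); last 2 first.
- by move=> x [? []].
- exact: preoo.
rewrite (lengthD (@measurable_cell Y h k) mSc SIc)// (length_cell Y k (ltW h0)).
rewrite lpre => H1.
have H2 := key _ mSc SIc.
rewrite ler_norml.
move: H1 H2; set s := length (S `&` _); set m := length (pre _).
set e := h * K * _ / _.
have -> : (h - s) * (p' - p) / h = (p' - p) - s / h * (p' - p).
  by field; rewrite gt_eqF.
have -> : s * (p' - p) / h = s / h * (p' - p) by rewrite mulrAC.
by move=> H1 H2; apply/andP; split; lra.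
Qed.

(** The left side is at most the length of the preimage of the cell, hence at most [h / beta]. If
    that preimage is nonempty, monotonicity places [b a] or [b (a + w)] in the cell; writing this
    with indicators lets the sum over [k] count at most two such cells. *)
Let partial_cell k : ~ (b a <= Y + k%:R * h /\ Y + k.+1%:R * h <= b (a + w)) ->
  `|length (pre (S `&` cell Y h k)) - ratio S Y h k * length (pre (cell Y h k))|
    <= h / beta * (\1_(cell Y h k) (b a) + \1_(cell Y h k) (b (a + w))).
Proof.
move=> nfull; set m := length (pre (S `&` _)); set rho := length (pre _).
have mSc : measurable (S `&` cell Y h k) by exact: measurableI.
have mr : m <= rho.
  apply: length_le; [exact: mpre|exact: mpre| |exact: preoo].
  by move=> x [? []].
have m0 : 0 <= m by exact: length_ge0.
have r0 := ratio_ge0 S Y k (ltW h0); have r1 := ratio_le1 Y k mS h0.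
have rr : 0 <= ratio S Y h k * rho <= rho.
  rewrite mulr_ge0 ?length_ge0//= -[leRHS]mul1r ler_wpM2r// length_ge0//.
have T : `|m - ratio S Y h k * rho| <= rho.
  by rewrite ler_norml; move: rr => /andP[? ?]; apply/andP; split; lra.
apply: (le_trans T); rewrite -mulrAC ler_pdivlMr// mulrC.
have [pre0|/set0P [x [Wx cx]]] := eqVneq (pre (cell Y h k)) set0.
  rewrite /rho pre0 /length measure0 mulr0; apply: mulr_ge0; first exact: ltW.
  by apply: addr_ge0; rewrite indicE.
apply: (le_trans (length_pre_cell k)); rewrite ler_peMr ?(ltW h0)//.
move: Wx cx; rewrite /W /cell /= !in_itv /= => /andP[ax xw] /andP[ux xv].
have bax := mono (lexx a) ax (ltW xw); have bxw := mono ax (ltW xw) (lexx _).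
rewrite !indicE !mem_setE !in_itv /=.
have [u1|u1] := leP (b a) (Y + k%:R * h); last first.
  by rewrite (ltW u1) (le_lt_trans bax xv) /= lerDl.
have -> : Y + k%:R * h <= b (a + w) by exact: le_trans bxw.
rewrite [X in _ + X%:R]/= (_ : b (a + w) < _); first by rewrite lerDr.
by rewrite ltNge; apply/negP => ?; apply: nfull.
Qed.

(** The first term collects the errors of the cells covered by the range of [b], each proportional
    to the length of its preimage, for a total length of at most [w]; the second accounts for the at
    most two cells that contain an end of the range. *)
Lemma osc_equi :
  `|\int[mu]_x (\1_W x * osc S Y h n (b x))| <=
     h * K * w / beta ^+ 2 + 2 * (h / beta).
Proof.
have bI E : measurable E -> bfun mu (\1_(pre E) : R -> R).
  by move=> mE; apply: bfun_indic; [exact: mpre|exact: preoo].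
have mSc k : measurable (S `&` cell Y h k) by exact: measurableI.
have E1 E x : \1_W x * \1_E (b x) = \1_(pre E) x :> R.
  by rewrite /pre !indicE in_setI -natrM mulnb; congr ((_ && _)%:R).
have bT k : bfun mu (fun x => \1_(pre (S `&` cell Y h k)) x -
    ratio S Y h k * \1_(pre (cell Y h k)) x).
  by apply: bfunB; [exact: bI|apply: bfunZ; exact: bI].
have -> : \int[mu]_x (\1_W x * osc S Y h n (b x)) = \sum_(k < n)
    (length (pre (S `&` cell Y h k)) - ratio S Y h k * length (pre (cell Y h k))).
  transitivity (\int[mu]_x (\sum_(k < n) (\1_(pre (S `&` cell Y h k)) x -
      ratio S Y h k * \1_(pre (cell Y h k)) x))).
    apply: eq_Rintegral => x _; rewrite mulr_sumr; apply: eq_bigr => k _.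
    by rewrite mulrBr mulrCA !E1.
  rewrite int_sum//; apply: eq_bigr => k _.
  rewrite intB; [|exact: bI|by apply: bfunZ; exact: bI].
  by rewrite intZ; [rewrite !int_indic//; exact: mpre|exact: bI].
have c0 : 0 <= h * K / beta ^+ 2.
  by apply: divr_ge0; [apply: mulr_ge0 => //; exact: ltW|exact: sqr_ge0].
have hb0 : 0 <= h / beta by apply: divr_ge0; exact: ltW.
apply: (le_trans (ler_norm_sum _ _ _)).
apply: (@le_trans _ _ (\sum_(k < n) (h * K / beta ^+ 2 * length (pre (cell Y h k)) +
    h / beta * (\1_(cell Y h k) (b a) + \1_(cell Y h k) (b (a + w)))))).
  apply: ler_sum => k _.
  have [[k1 k2]|] := pselect (b a <= Y + k%:R * h /\ Y + k.+1%:R * h <= b (a + w)).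
    apply: (le_trans (full_cell k1 k2)); rewrite mulrAC lerDl; apply: mulr_ge0 => //.
  move=> /partial_cell /le_trans; apply; rewrite lerDr mulr_ge0//.
  exact: length_ge0.
rewrite big_split /= -!mulr_sumr big_split /= !sum_cell ?(ltW h0)//.
apply: lerD.
  rewrite [leRHS]mulrAC ler_wpM2l//.
  have -> : \sum_(k < n) length (pre (cell Y h k)) =
      \int[mu]_x (\sum_(k < n) \1_(pre (cell Y h k)) x).
    rewrite int_sum; last by move=> k; exact: bI.
    by apply: eq_bigr => k _; rewrite int_indic//; exact: mpre.
  have lW : \int[mu]_x \1_W x = w.
    rewrite int_indic; last exact: measurable_itv.
    rewrite -/(length W) length_itvco; first by ring.
    by rewrite lerDl.
  rewrite -[leRHS]lW; apply: le_int.
  - by apply: bfun_sum => k; exact: bI.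
  - by apply: bfun_indic => //; exact: measurable_itv.
  move=> x; under eq_bigr do rewrite -E1.
  rewrite -mulr_sumr sum_cell ?(ltW h0)// !indicE.
  by case: (x \in W); case: (_ \in _); rewrite ?(mulr0, mulr1).
rewrite mulrC ler_wpM2r// !indicE.
by case: (_ \in _); case: (_ \in _); rewrite ?addr0 ?add0r ?ler1n//=; lra.
Qed.

End Equi.
End Cells.


(** * Circular arcs and the difference of two of them *)

Section Arc.
Context (R : realType).
Local Notation mu := (@lebesgue_measure R).

Definition arc (lam s x : R) : R := Num.sqrt (lam ^+ 2 - (x - s) ^+ 2).

(** This is minus the derivative of the arc, at horizontal offset [u] from its centre. *)
Let slope (lam u : R) : R := u / Num.sqrt (lam ^+ 2 - u ^+ 2).

(** The constant [4 / 5] is a rational number below [sqrt (3 / 4)]. *)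
Lemma arc_bounds (lam s x : R) : 0 < lam -> `|x - s| <= lam / 2 ->
  [/\ 0 < lam ^+ 2 - (x - s) ^+ 2, 4 / 5 * lam <= arc lam s x <= lam &
      arc lam s x ^+ 2 = lam ^+ 2 - (x - s) ^+ 2].
Proof.
move=> l0 xs; have h1 : (x - s) ^+ 2 <= lam ^+ 2 / 4.
  rewrite -real_normK ?num_real//.
  apply: le_trans (_ : (lam / 2) ^+ 2 <= _); last first.
    by rewrite expr_div_n; lra.
  by rewrite ler_pXn2r// ?nnegrE// divr_ge0// ltW.
have l2 : 0 < lam ^+ 2 by rewrite exprn_gt0.
have h2 : 0 <= (x - s) ^+ 2 by exact: sqr_ge0.
have h3 : 0 < lam ^+ 2 - (x - s) ^+ 2 by lra.
split => //; last by rewrite sqr_sqrtr// ltW.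
have e1 : Num.sqrt ((4 / 5 * lam) ^+ 2) = 4 / 5 * lam.
  by rewrite sqrtr_sqr ger0_norm// mulr_ge0// ltW.
have e2 : Num.sqrt (lam ^+ 2) = lam by rewrite sqrtr_sqr ger0_norm// ltW.
apply/andP; split.
  by rewrite -e1 ler_sqrt ?ltW// exprMn; lra.
by rewrite -[leRHS]e2 ler_sqrt; lra.
Qed.

(** With [C] and [C'] the two square roots, the difference factors as [u - v] times [(lam ^+ 2 + C *
    C' + u * v) / ((C + C') * (C * C'))]. The numerator lies between [2 * (C * C')] and
    [16 / 5 * (C * C')], and [C + C'] between [8 / 5 * lam] and [2 * lam]. *)
Lemma slope_bounds (lam u v : R) : 0 < lam -> `|u| <= lam / 2 -> `|v| <= lam / 2 ->
  v <= u -> (u - v) / lam <= slope lam u - slope lam v <= 2 * (u - v) / lam.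
Proof.
move=> l0 ul vl vu.
have [hu /andP[Cu1 Cu2] Cu] : [/\ 0 < lam ^+ 2 - u ^+ 2,
    4 / 5 * lam <= Num.sqrt (lam ^+ 2 - u ^+ 2) <= lam &
    Num.sqrt (lam ^+ 2 - u ^+ 2) ^+ 2 = lam ^+ 2 - u ^+ 2].
  by have := @arc_bounds lam 0 u; rewrite /arc subr0; apply.
have [hv /andP[Cv1 Cv2] Cv] : [/\ 0 < lam ^+ 2 - v ^+ 2,
    4 / 5 * lam <= Num.sqrt (lam ^+ 2 - v ^+ 2) <= lam &
    Num.sqrt (lam ^+ 2 - v ^+ 2) ^+ 2 = lam ^+ 2 - v ^+ 2].
  by have := @arc_bounds lam 0 v; rewrite /arc subr0; apply.
rewrite /slope; move: (Num.sqrt _) Cu1 Cu2 Cu => C Cu1 Cu2 Cu.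
move: (Num.sqrt _) Cv1 Cv2 Cv => C' Cv1 Cv2 Cv.
have C0 : 0 < C by lra.
have C'0 : 0 < C' by lra.
have CC0 : 0 < C * C' by rewrite mulr_gt0.
have -> : u / C - v / C' = (u - v) * ((lam ^+ 2 + C * C' + u * v) / ((C + C') * (C * C'))).
  have -> : lam ^+ 2 = u ^+ 2 + C ^+ 2 by rewrite Cu; ring.
  have E : C ^+ 2 - C' ^+ 2 = v ^+ 2 - u ^+ 2 by rewrite Cu Cv; ring.
  (* The factorisation holds only modulo the relation [E]; the defect is displayed as a separate
     term so that [field] applies, and then vanishes by [E]. *)
  have -> : (u - v) * ((u ^+ 2 + C ^+ 2 + C * C' + u * v) / ((C + C') * (C * C'))) =
    u / C - v / C' + (u * (C ^+ 2 - C' ^+ 2 - (v ^+ 2 - u ^+ 2))) / ((C + C') * (C * C')).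
    by field; rewrite !gt_eqF// addr_gt0.
  by rewrite E subrr mulr0 mul0r addr0.
have uv0 : 0 <= u - v by lra.
have D0 : 0 < (C + C') * (C * C') by rewrite mulr_gt0// addr_gt0.
have uv : u * v <= lam ^+ 2 / 4 /\ C * C' - u * v <= lam ^+ 2.
  split.
    apply: (le_trans (ler_norm _)); rewrite normrM.
    have -> : lam ^+ 2 / 4 = (lam / 2) * (lam / 2) by rewrite expr2; lra.
    by apply: ler_pM.
  have := sqr_ge0 (C - C'); have := sqr_ge0 (u + v).
  rewrite sqrrB sqrrD Cu Cv; lra.
have CC1 : 16 / 25 * lam ^+ 2 <= C * C'.
  have -> : 16 / 25 * lam ^+ 2 = (4 / 5 * lam) * (4 / 5 * lam) by rewrite expr2; lra.
  by apply: ler_pM => //; lra.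
have CC2 : C * C' <= lam ^+ 2 by rewrite expr2; apply: ler_pM => //; exact: ltW.
rewrite [2 * _ / _]mulrAC [2 / _ * _]mulrC; case: uv => uv1 uv2.
apply/andP; split; apply: ler_wpM2l => //.
  rewrite ler_pdivlMr// mulrC ler_pdivrMr//.
  apply: (@le_trans _ _ (2 * lam * (C * C'))).
    by apply: ler_wpM2r; [exact: ltW|lra].
  have : lam * (2 * (C * C')) <= lam * (lam ^+ 2 + C * C' + u * v).
    by apply: ler_wpM2l; [exact: ltW|lra].
  lra.
rewrite ler_pdivrMr// mulrAC ler_pdivlMr//.
apply: (@le_trans _ _ (16 / 5 * (C * C') * lam)).
  by apply: ler_wpM2r; [exact: ltW|lra].
have -> : 16 / 5 * (C * C') * lam = 2 * (8 / 5 * lam * (C * C')) by field.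
apply: ler_wpM2l => //; apply: ler_wpM2r; [exact: ltW|lra].
Qed.

Lemma arc_derive (lam s x : R) : 0 < lam -> `|x - s| <= lam / 2 ->
  is_derive x 1 (arc lam s) (- slope lam (x - s)).
Proof.
move=> l0 xs; have [h1 _ _] := arc_bounds l0 xs.
have d1 : is_derive x 1 (fun x : R => lam ^+ 2 - (x - s) ^+ 2) (- (2 * (x - s))).
  by apply: is_derive_eq; rewrite /GRing.scale/=; ring.
have d2 := is_derive1_sqrt h1.
have := @is_derive1_comp _ Num.sqrt (fun x : R => lam ^+ 2 - (x - s) ^+ 2) x _ _ d2 d1.
rewrite (_ : (2 * _)^-1 * _ = - slope lam (x - s))//.
rewrite /slope; field.
by rewrite gt_eqF// sqrtr_gt0.
Qed.

Lemma continuous_arc (lam s : R) : continuous (arc lam s).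
Proof.
move=> x; rewrite /arc.
apply: (@continuous_comp _ _ _ (fun x : R => lam ^+ 2 - (x - s) ^+ 2) Num.sqrt);
  last exact: sqrt_continuous.
apply: continuousB; first exact: cst_continuous.
apply: (@continuous_comp _ _ _ (fun x : R => x - s) (fun x : R => x ^+ 2)).
  by apply: continuousB => //; exact: cst_continuous.
exact: exprn_continuous.
Qed.

Section TwoArcs.
Variables (lam a w s t sigma : R).
Hypotheses (lam0 : 0 < lam) (lamw : lam = 2 * w) (sigma0 : 0 < sigma)
  (ast : a <= s) (st : s + sigma <= t) (taw : t <= a + w).

Let b (x : R) : R := arc lam t x - arc lam s x.
Let db (x : R) : R := slope lam (x - s) - slope lam (x - t).

Let near_s x : a <= x -> x <= a + w -> `|x - s| <= lam / 2.
Proof.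
move=> ax xw; have := ast; have := st; have := taw; have := lamw; have := sigma0.
by move=> *; rewrite ler_norml; apply/andP; split; lra.
Qed.

Let near_t x : a <= x -> x <= a + w -> `|x - t| <= lam / 2.
Proof.
move=> ax xw; have := ast; have := st; have := taw; have := lamw; have := sigma0.
by move=> *; rewrite ler_norml; apply/andP; split; lra.
Qed.

Let continuous_b : continuous b.
Proof. by move=> x; apply: continuousB; exact: continuous_arc. Qed.

Let mvt x y : a <= x -> x <= y -> y <= a + w ->
  exists c, [/\ x <= c, c <= y & b y - b x = db c * (y - x)].
Proof.
move=> ax xy yw.
have d c : c \in `]x, y[%R -> is_derive c 1 b (db c).
  rewrite in_itv /= => /andP[xc cy].
  have ac : a <= c by apply: le_trans ax (ltW xc).
  have cw : c <= a + w by apply: le_trans (ltW cy) yw.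
  have d1 := arc_derive lam0 (near_t ac cw); have d2 := arc_derive lam0 (near_s ac cw).
  rewrite (_ : db c = - slope lam (c - t) - - slope lam (c - s)); last by rewrite /db; ring.
  exact: is_deriveB.
have [] := MVT_segment xy d.
  by apply: continuous_subspaceT; exact: continuous_b.
move=> c; rewrite in_itv /= => /andP[xc cy] e.
by exists c.
Qed.

Let db_ge c : a <= c -> c <= a + w -> sigma / lam <= db c.
Proof.
move=> ac cw; have st' : c - t <= c - s by have := st; have := sigma0 => *; lra.
have /andP[h _] := slope_bounds lam0 (near_s ac cw) (near_t ac cw) st'.
apply: le_trans h; rewrite ler_wpM2r ?invr_ge0 ?(ltW lam0)//.
by have := st; lra.
Qed.

(** The variation of [db] is a difference of two increments of [slope] of the same sign, each at
    most [2 / lam * |c - d|] in absolute value; hence the constant is 2 and not 4. *)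
Let db_lip c d : a <= c -> c <= a + w -> a <= d -> d <= a + w ->
  db c <= db d + 2 / lam * `|c - d|.
Proof.
move=> ac cw ad dw; rewrite /db.
have [cd|dc] := leP c d.
  have cds : c - s <= d - s by lra.
  have cdt : c - t <= d - t by lra.
  have /andP[h1 h2] := slope_bounds lam0 (near_s ad dw) (near_s ac cw) cds.
  have /andP[h3 h4] := slope_bounds lam0 (near_t ad dw) (near_t ac cw) cdt.
  have e : 0 <= (d - s - (c - s)) / lam by rewrite divr_ge0 ?(ltW lam0)//; lra.
  rewrite distrC ger0_norm ?subr_ge0//.
  rewrite (_ : 2 / lam * (d - c) = 2 * (d - t - (c - t)) / lam); first lra.
  by field; rewrite gt_eqF.
have cds : d - s <= c - s by lra.
have cdt : d - t <= c - t by lra.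
have /andP[h1 h2] := slope_bounds lam0 (near_s ac cw) (near_s ad dw) cds.
have /andP[h3 h4] := slope_bounds lam0 (near_t ac cw) (near_t ad dw) cdt.
have e : 0 <= (c - t - (d - t)) / lam by rewrite divr_ge0 ?(ltW lam0)//; lra.
rewrite ger0_norm ?subr_ge0 ?(ltW dc)//.
rewrite (_ : 2 / lam * (c - d) = 2 * (c - s - (d - s)) / lam); first lra.
by field; rewrite gt_eqF.
Qed.

(** This is [osc_equi] with [beta = sigma / lam] and [K = 2 / lam]. The window has width [lam / 2],
    so [K * w = 1]. *)
Lemma osc_equi_arc (S : set R) (Y h : R) n y : measurable S -> 0 < h ->
  `|\int[mu]_x (\1_(`[a, a + w[%classic) x *
       osc S Y h n (y + (arc lam t x - arc lam s x)))| <=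
     h / (sigma / lam) ^+ 2 + 2 * (h / (sigma / lam)).
Proof.
move=> mS h0.
have w0 : 0 <= w by have := lam0; have := lamw => *; lra.
have aw : a <= a + w by lra.
have -> : h / (sigma / lam) ^+ 2 = h * (2 / lam) * w / (sigma / lam) ^+ 2.
  by rewrite lamw; field; rewrite !gt_eqF//; have := lam0; rewrite lamw; lra.
have yb u v : y + b u - (y + b v) = b u - b v by ring.
apply: (@osc_equi _ S Y h n a w (fun x => y + b x)) => //.
- apply: measurable_funD => //; apply: continuous_measurable_fun.
  exact: continuous_b.
- by rewrite divr_gt0.
- by rewrite divr_ge0// ltW.
- move=> x z ax xz zw; have [c [xc cz]] := mvt ax xz zw; rewrite yb => ->.
  rewrite ler_wpM2r ?subr_ge0//; apply: db_ge; first exact: le_trans xc.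
  exact: le_trans cz zw.
- move=> p x z q ap px xz zq qw; rewrite !yb.
  have [c [pc cq]] := mvt ap (le_trans px (le_trans xz zq)) qw => ->.
  have [d [xd dz]] := mvt (le_trans ap px) xz (le_trans zq qw) => ->.
  rewrite -[X in X <= _]mulrA [(q - p) * _]mulrC mulrA.
  apply: ler_wpM2r; first by rewrite subr_ge0 (le_trans px)// (le_trans xz).
  rewrite -mulrDl; apply: ler_wpM2r; first by rewrite subr_ge0.
  apply: le_trans (db_lip (le_trans ap pc) (le_trans cq qw) _ _) _.
  + by apply: le_trans xd; exact: le_trans px.
  + by apply: (le_trans dz); exact: le_trans qw.
  + rewrite lerD2l ler_wpM2l//; first by rewrite divr_ge0// ltW.
    rewrite ler_norml; apply/andP; split; lra.
- move=> v vb; have cb : {within `[a, a + w], continuous (fun x => y + b x)}.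
    apply: continuous_subspaceT => x; apply: continuousD; first exact: cst_continuous.
    exact: continuous_b.
  have bb : y + b a <= y + b (a + w) by case/andP: vb => v1; exact: le_trans.
  have := @IVT _ _ _ _ v aw cb; rewrite (min_idPl bb) (max_idPr bb) => /(_ vb)[c].
  by rewrite in_itv /= => ? ?; exists c.
Qed.

End TwoArcs.
End Arc.


(** * Separated columns, and the energy forced by avoidance *)

Section Columns.
Context (R : realType).
Local Notation mu := (@lebesgue_measure R).
#[local] Hint Extern 0 (measurable (cell _ _ _)) => exact: measurable_cell : core.
#[local] Hint Extern 0 (is_true (lebesgue_measure (cell _ _ _) < +oo)%E) =>
  exact: cell_lty : core.

Lemma bfun_itv (a b : R) : bfun mu (\1_(`[a, b[%classic) : R -> R).
Proof. by apply: bfun_indic; [exact: measurable_itv|exact: measure_itvco_lty]. Qed.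

Lemma int_itv (a b : R) : a <= b -> \int[mu]_x \1_(`[a, b[%classic) x = b - a.
Proof.
move=> ab; rewrite int_indic; last exact: measurable_itv.
by rewrite -/(length _) length_itvco.
Qed.

(** A greedy choice: each point already chosen forbids an interval of length [2 * sigma], and the
    forbidden intervals cannot cover [G]. *)
Lemma separated_points (G : set R) (sigma : R) (N : nat) : measurable G ->
  (mu G < +oo)%E -> 0 <= sigma -> 2 * N%:R * sigma < length G ->
  exists x : nat -> R, (forall i, (i < N)%N -> G (x i)) /\
    forall i j, (i < N)%N -> (j < N)%N -> i != j -> sigma <= `|x i - x j|.
Proof.
move=> mG Goo s0; elim: N => [|N IH] lG.
  by exists (fun=> 0); split.
have [|x [xG xs]] := IH.
  apply: le_lt_trans lG; rewrite ler_wpM2r// ler_wpM2l//.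
  by rewrite ler_nat.
have [z [Gz zs]] : exists z, G z /\ forall i, (i < N)%N -> sigma <= `|z - x i|.
  apply: contrapT => H; move: lG; apply/negP; rewrite -leNgt.
  apply: (@le_trans _ _ (\sum_(i < N) \int[mu]_z \1_(`[x i - sigma, x i + sigma[%classic) z)).
    rewrite -int_sum; last by move=> i; exact: bfun_itv.
    rewrite /length -int_indic//; apply: le_int.
    - exact: bfun_indic.
    - by apply: bfun_sum => i; exact: bfun_itv.
    move=> z; rewrite indicE; have [/set_mem Gz|_] := boolP (z \in G); last first.
      by apply: sumr_ge0 => i _; rewrite indicE.
    have [i iN] : exists2 i, (i < N)%N & `|z - x i| < sigma.
      apply: contrapT => H'; apply: H; exists z; split => // i iN.
      by rewrite leNgt; apply/negP => h; apply: H'; exists i.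
    rewrite ltr_norml => /andP[h1 h2].
    rewrite (bigD1 (Ordinal iN)) //= indicE mem_set; last first.
      by rewrite /= in_itv /=; apply/andP; split; lra.
    by rewrite lerDl; apply: sumr_ge0 => j _; rewrite indicE.
  rewrite (eq_bigr (fun=> 2 * sigma)) => [|i _]; last first.
    by rewrite int_itv; [ring|lra].
  rewrite sumr_const card_ord -mulr_natr -natr1.
  by have := s0; lra.
exists (fun i => if (i < N)%N then x i else z); split => [i|i j].
  by rewrite ltnS leq_eqVlt => /orP[/eqP ->|iN]; rewrite ?ltnn// iN; exact: xG.
rewrite !ltnS => iN jN ij; case: (ltnP i N) => iN'; case: (ltnP j N) => jN'.
- exact: xs.
- by rewrite distrC; exact: zs.
- exact: zs.
- by move: ij; rewrite eqn_leq (leq_trans iN jN') (leq_trans jN iN').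
Qed.

Definition avg (S : set R) Y h n u : R := \sum_(k < n) ratio S Y h k * \1_(cell Y h k) u.

Section OneSet.
Variables (S : set R) (Y h : R) (n : nat).
Hypotheses (mS : measurable S) (h0 : 0 < h).
Let c := `[Y, Y + n%:R * h[%classic.

Let mSc k : measurable (S `&` cell Y h k). Proof. exact: measurableI. Qed.

Let Scoo k : (mu (S `&` cell Y h k) < +oo)%E.
Proof. exact: (sub_lty (mSc k) _ (@subIsetr _ _ _)). Qed.

Let bcell k : bfun mu (\1_(cell Y h k) : R -> R).
Proof. by apply: bfun_indic; [exact: measurable_cell|exact: cell_lty]. Qed.

Lemma oscE u : osc S Y h n u = \1_(S `&` c) u - avg S Y h n u.
Proof.
rewrite /osc sumrB; congr (_ - _).
rewrite indicE in_setI -mulnb natrM -!indicE -(sum_cell Y n u (ltW h0)) mulr_sumr.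
by apply: eq_bigr => k _; rewrite !indicE in_setI -mulnb natrM.
Qed.

Lemma avg_bounds u : 0 <= avg S Y h n u <= \1_c u.
Proof.
apply/andP; split.
  apply: sumr_ge0 => k _; apply: mulr_ge0; last by rewrite indicE.
  by apply: ratio_ge0; exact: ltW.
rewrite /avg -(sum_cell Y n u (ltW h0)); apply: ler_sum => k _; rewrite -[leRHS]mul1r.
by apply: ler_wpM2r; [rewrite indicE|exact: ratio_le1].
Qed.

Lemma osc_bound u : `|osc S Y h n u| <= \1_c u.
Proof.
rewrite oscE; have /andP[a0 a1] := avg_bounds u.
have : 0 <= (\1_(S `&` c) u : R) <= \1_c u.
  by rewrite !indicE in_setI; case: (u \in S); case: (u \in c); rewrite /= ?lexx ?ler01.
by move=> /andP[? ?]; rewrite ler_norml; apply/andP; split; lra.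
Qed.

Lemma bfun_avg : bfun mu (avg S Y h n).
Proof. by apply: bfun_sum => k; apply: bfunZ; exact: bcell. Qed.

Lemma bfun_osc : bfun mu (osc S Y h n).
Proof.
apply: bfun_sum => k; apply: bfunB; first by apply: bfun_indic; [exact: mSc|exact: Scoo].
by apply: bfunZ; exact: bcell.
Qed.

Lemma sum_ratio : \sum_(k < n) ratio S Y h k = length (S `&` c) / h.
Proof.
rewrite -mulr_suml; congr (_ / h).
have mSC : measurable (S `&` c) by apply: measurableI => //; exact: measurable_itv.
have lE k : length (S `&` cell Y h k) = \int[mu]_u \1_(S `&` cell Y h k) u.
  by rewrite int_indic; last exact: mSc.
rewrite (eq_bigr (fun k : 'I_n => \int[mu]_u \1_(S `&` cell Y h k) u)) => [|k _]; last exact: lE.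
rewrite /length -int_indic//.
rewrite -int_sum; last by move=> k; by apply: bfun_indic; [exact: mSc|exact: Scoo].
apply: eq_Rintegral => u _.
rewrite [RHS]indicE in_setI -mulnb natrM -!indicE -(sum_cell Y n u (ltW h0)) mulr_sumr.
by apply: eq_bigr => k _; rewrite !indicE in_setI -mulnb natrM.
Qed.

(** A passage from mean square to mean absolute deviation. *)
Lemma int_avg_dist (phi s : R) : 0 < s ->
  \sum_(k < n) (ratio S Y h k - phi) ^+ 2 <= s ^+ 2 * n%:R ->
  \int[mu]_u `|avg S Y h n u - phi * \1_c u| <= s * (n%:R * h).
Proof.
move=> s0 H.
apply: (@le_trans _ _ (\int[mu]_u \sum_(k < n) (`|ratio S Y h k - phi| * \1_(cell Y h k) u))).
  apply: le_int.
  - by apply: bfun_norm; apply: bfunB; [exact: bfun_avg|apply: bfunZ; exact: bfun_itv].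
  - by apply: bfun_sum => k; apply: bfunZ; exact: bcell.
  move=> u; rewrite /avg -(sum_cell Y n u (ltW h0)) mulr_sumr -sumrB.
  apply: le_trans (ler_norm_sum _ _ _) _; apply: ler_sum => k _.
  by rewrite -mulrBl normrM [`|\1_ _ u|]ger0_norm// indicE.
rewrite int_sum; last by move=> k; apply: bfunZ; exact: bcell.
rewrite (eq_bigr (fun k : 'I_n => `|ratio S Y h k - phi| * h)) => [|k _]; last first.
  rewrite intZ; last exact: bcell.
  congr (_ * _); rewrite -[RHS](length_cell Y k (ltW h0)).
  exact: (int_indic mu (@measurable_cell _ Y h k)).
rewrite -mulr_suml mulrA; apply: ler_wpM2r; first exact: ltW.
(* In place of Cauchy-Schwarz, [z <= z ^+ 2 / (2 * s) + s / 2] for each term. *)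
apply: (@le_trans _ _ (\sum_(k < n) ((ratio S Y h k - phi) ^+ 2 / (2 * s) + s / 2))).
  apply: ler_sum => k _; rewrite -real_normK ?num_real//.
  move: (`|_|) => z; have : 0 <= (z - s) ^+ 2 / (2 * s).
    by rewrite divr_ge0 ?sqr_ge0// mulr_ge0// ltW.
  have -> : (z - s) ^+ 2 / (2 * s) = z ^+ 2 / (2 * s) + s / 2 - z.
    by field; rewrite gt_eqF.
  by rewrite subr_ge0.
rewrite big_split /= -mulr_suml sumr_const card_ord -mulr_natr.
have : (\sum_(k < n) (ratio S Y h k - phi) ^+ 2) / (2 * s) <= s / 2 * n%:R.
  rewrite ler_pdivrMr ?mulr_gt0//.
  by rewrite (_ : s / 2 * n%:R * (2 * s) = s ^+ 2 * n%:R)//; field.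
lra.
Qed.

End OneSet.
End Columns.


Section ColumnEnergy.
Context (R : realType).
Local Notation mu := (@lebesgue_measure R).

(** For [y] in [B] the point [y + D i] misses [S i], so the oscillation there is minus the cell
    average, which is about minus the density of the column, hence at most about [- eta]. The [N]
    oscillations thus add up to about [- N * eta] on most of [B]. *)
Lemma column_energy (N n : nat) (B : set R) (S : 'I_N -> set R) (D : 'I_N -> R)
    (Y h eta lam s : R) :
  let H := n%:R * h in let c := `[Y, Y + H[%classic in
  (0 < N)%N -> 0 < h -> 0 < eta <= 1 -> 0 < s ->
  measurable B -> B `<=` c -> eta * H <= length B ->
  (forall i, measurable (S i)) ->
  (forall i, eta * H <= length (S i `&` c)) ->
  (forall i, \sum_(k < n) (ratio (S i) Y h k - length (S i `&` c) / H) ^+ 2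
     <= s ^+ 2 * n%:R) ->
  (forall i, 0 <= D i <= lam) ->
  (forall i y, B y -> ~ S i (y + D i)) ->
  lam + s * H <= eta ^+ 2 * H / 4 ->
  N%:R ^+ 2 * eta ^+ 3 * H / 2 <=
    \int[mu]_y (\sum_i osc (S i) Y h n (y + D i)) ^+ 2.
Proof.
move=> H c N0 h0 /andP[eta0 eta1] s0 mB Bc lB mS lS oS DD avoid small.
have Nr : 0 < N%:R :> R by rewrite ltr0n.
have H0 : 0 <= H by rewrite mulr_ge0// ltW.
have lam0 : 0 <= lam by have /andP[d1 d2] := DD (Ordinal N0); exact: le_trans d2.
pose Z y := \sum_i osc (S i) Y h n (y + D i).
pose phi i := length (S i `&` c) / H.
pose A i u := `|avg (S i) Y h n u - phi i * \1_c u|.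
(* For [y] in this top strip the shifted point may leave [c]; the strip costs [lam] per column,
   while [A i] accounts for columns that are not exactly equidistributed among the cells. *)
pose e := `[Y + H - lam, Y + H[%classic.
have Boo : (mu B < +oo)%E.
  by apply: sub_lty Bc _ => //; [exact: measurable_itv|exact: measure_itvco_lty].
have bB : bfun mu (\1_B : R -> R) by exact: bfun_indic.
have bA i : bfun mu (A i).
  apply: bfun_norm; apply: bfunB; first exact: bfun_avg.
  by apply: bfunZ; exact: bfun_itv.
have bAs i : bfun mu (fun y => A i (y + D i)) by exact: bfun_shift.
have bZ : bfun mu Z by apply: bfun_sum => i; apply: bfun_shift; exact: bfun_osc.
have bZ2 : bfun mu (fun y => Z y ^+ 2) by exact: bfunM.
have pt i y : eta * \1_B y <= - osc (S i) Y h n (y + D i) * \1_B y + \1_e y + A i (y + D i).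
  have A0 : 0 <= A i (y + D i) by exact: normr_ge0.
  have e0 : 0 <= (\1_e y : R) by rewrite indicE.
  have [/set_mem By|nB] := boolP (y \in B); last first.
    by rewrite !indicE (negbTE nB) !mulr0 add0r; rewrite indicE in e0; exact: addr_ge0.
  rewrite [\1_B y]indicE mem_set// !mulr1 oscE// indicE memNset; last first.
    by move=> [/(avoid i y By)].
  rewrite sub0r opprK.
  have := Bc _ By; rewrite /c /= in_itv /= => /andP[Yy yH].
  have /andP[D0 Dl] := DD i.
  have /andP[a0 _] := avg_bounds Y n (mS i) h0 (y + D i).
  have [uH|Hu] := ltP (y + D i) (Y + H).
    have ue : y + D i \in c.
      by rewrite inE /c /= in_itv /= uH andbT; apply: (le_trans Yy); rewrite lerDl.
    have phi1 : eta <= phi i.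
      have [H1|H1] := ltP 0 H; first by rewrite ler_pdivlMr// ; exact: lS.
      by have := le_lt_trans Yy yH; rewrite ltrDl ltNge H1.
    have := ler_norm (- (avg (S i) Y h n (y + D i) - phi i * \1_c (y + D i))).
    rewrite normrN -/(A i (y + D i)) [\1_c _]indicE ue mulr1.
    by move: (avg _ _ _ _ _) a0 => v; lra.
  rewrite [X in _ + X + _]indicE mem_set; last first.
    by rewrite /e /= in_itv /= yH andbT; lra.
  rewrite [(true : nat)%:R](_ : _ = 1)//.
  by move: (avg _ _ _ _ _) (A i _) a0 A0 => v z a0 A0; lra.
have Ne0 : 0 < N%:R * eta by rewrite mulr_gt0.
have pt2 y : N%:R * eta / 2 * \1_B y <=
    (2 * (N%:R * eta))^-1 * Z y ^+ 2 + (N%:R * \1_e y + \sum_i A i (y + D i)).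
  have H1 : N%:R * eta * \1_B y <= - Z y * \1_B y + N%:R * \1_e y + \sum_i A i (y + D i).
    have -> : N%:R * eta * \1_B y = \sum_(i < N) eta * \1_B y.
      by rewrite sumr_const card_ord -mulrA mulr_natl.
    have -> : - Z y * \1_B y + N%:R * \1_e y + \sum_i A i (y + D i) =
        \sum_i (- osc (S i) Y h n (y + D i) * \1_B y + \1_e y + A i (y + D i)).
      by rewrite !big_split /= -mulr_suml sumrN sumr_const card_ord mulr_natl.
    by apply: ler_sum => i _; exact: pt.
  (* Completing the square keeps half of the main term. After integration the errors, at most
     [N * (lam + s * H)], take at most half of what remains, which is the origin of
     [eta ^+ 2 * H / 4]. *)
  have H2 : - Z y * \1_B y <= (2 * (N%:R * eta))^-1 * Z y ^+ 2 + N%:R * eta / 2 * \1_B y.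
    rewrite indicE; case: (y \in B); rewrite ?mulr1 ?mulr0 ?addr0; last first.
      by rewrite mulr_ge0 ?sqr_ge0// invr_ge0 mulr_ge0// ltW.
    rewrite -subr_ge0 (_ : _ - _ = (2 * (N%:R * eta))^-1 * (Z y + N%:R * eta) ^+ 2).
      by rewrite mulr_ge0 ?sqr_ge0// invr_ge0 mulr_ge0// ltW.
    by field; rewrite !gt_eqF.
  lra.
have := le_int (bfunZ (N%:R * eta / 2) bB)
  (bfunD (bfunZ (2 * (N%:R * eta))^-1 bZ2)
    (bfunD (bfunZ N%:R (bfun_itv (Y + H - lam) (Y + H)))
      (bfun_sum (index_enum 'I_N) xpredT bAs))) pt2.
rewrite intZ// int_indic// -/(length B).
rewrite intD; [|exact: bfunZ|]; last first.
  by apply: bfunD; [apply: bfunZ; exact: bfun_itv|exact: bfun_sum].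
rewrite intZ// intD; [|by apply: bfunZ; exact: bfun_itv|exact: bfun_sum].
rewrite intZ; last exact: bfun_itv.
rewrite int_itv; last by lra.
rewrite int_sum//.
have sA : \sum_i \int[mu]_y A i (y + D i) <= N%:R * (s * H).
  have -> : N%:R * (s * H) = \sum_(i < N) (s * H).
    by rewrite sumr_const card_ord mulr_natl.
  apply: ler_sum => i _; rewrite int_shift//.
  exact: int_avg_dist.
have lB2 : N%:R * eta / 2 * (eta * H) <= N%:R * eta / 2 * length B.
  by apply: ler_wpM2l => //; rewrite divr_ge0// ltW.
have sm2 := ler_wpM2l (ltW Nr) small.
move=> M.
have M2 : N%:R * (eta ^+ 2 * H / 4) <= (2 * (N%:R * eta))^-1 * \int[mu]_y Z y ^+ 2.
  rewrite expr2 in sm2 *; lra.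
have P0 : 0 < 2 * (N%:R * eta) by rewrite mulr_gt0.
have := ler_wpM2l (ltW P0) M2; rewrite mulVKf ?(gt_eqF P0)//; apply: le_trans.
by rewrite le_eqVlt; apply/orP; left; apply/eqP; rewrite !exprS expr0; field.
Qed.

End ColumnEnergy.


(** * Near orthogonality of the shifted oscillations *)

Section CellLemma.
Context (R : realType).
Local Notation mu := (@lebesgue_measure R).

Definition correlation (S T : set R) Y h n lam s t x : R :=
  \int[mu]_y (osc S Y h n (y + arc lam s x) * osc T Y h n (y + arc lam t x)).

Lemma correlationC S T Y h n lam s t x :
  correlation S T Y h n lam s t x = correlation T S Y h n lam t s x.
Proof. by apply: eq_Rintegral => y _; rewrite mulrC. Qed.

Section Correlation.
Variables (S T : set R) (Y h : R) (n : nat) (lam a w s t : R).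
Hypotheses (mS : measurable S) (mT : measurable T) (h0 : 0 < h).
Let W := `[a, a + w[%classic.
Let c := `[Y, Y + n%:R * h[%classic.
(** The translation of [y] by the first arc frees the first factor from [x]; only the difference of
    the two arcs remains in the second. *)
Let F (z : R * R) : R := \1_W z.1 *
  (osc S Y h n z.2 * osc T Y h n (z.2 + (arc lam t z.1 - arc lam s z.1))).

Let indic01 (A : set R) x : 0 <= (\1_A x : R) <= 1.
Proof. by rewrite indicE; case: (x \in A); rewrite /= ?lexx ?ler01. Qed.

Let osc_le1 A u : measurable A -> `|osc A Y h n u| <= 1.
Proof.
move=> mA; apply: (le_trans (osc_bound Y n mA h0 u)).
by have /andP[] := indic01 `[Y, Y + n%:R * h[%classic u.
Qed.

Let mosc A : measurable A -> measurable_fun setT (osc A Y h n).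
Proof. by move=> mA; case: (bfun_osc Y h n mA). Qed.

Let FE x : \1_W x * correlation S T Y h n lam s t x = \int[mu]_y F (x, y).
Proof.
rewrite /F /= intZ; last first.
  by apply: bfunM; [exact: bfun_osc|apply: bfun_shift; exact: bfun_osc].
congr (_ * _); rewrite /correlation.
rewrite -[RHS](int_shift (arc lam s x)); last first.
  by apply: bfunM; [exact: bfun_osc|apply: bfun_shift; exact: bfun_osc].
apply: eq_Rintegral => y _; congr (_ * osc _ _ _ _ _); ring.
Qed.

Let F_swap : [/\ bfun mu (fun x => \int[mu]_y F (x, y)),
      bfun mu (fun y => \int[mu]_x F (x, y)) &
      \int[mu]_x \int[mu]_y F (x, y) = \int[mu]_y \int[mu]_x F (x, y)].
Proof.
have marc u : measurable_fun setT (arc lam u).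
  by apply: continuous_measurable_fun; exact: continuous_arc.
apply: (@fubini_swap _ F 1 W c).
- apply: measurable_funM.
    by apply: measurableT_comp; [by apply: measurable_indic; exact: measurable_itv|exact: measurable_fst].
  apply: measurable_funM.
    by apply: measurableT_comp; [exact: mosc|exact: measurable_snd].
  apply: measurableT_comp; first exact: mosc.
  apply: measurable_funD; first exact: measurable_snd.
  by apply: measurable_funB; apply: measurableT_comp; (exact: marc||exact: measurable_fst).
- exact: measurable_itv.
- exact: measure_itvco_lty.
- exact: measurable_itv.
- exact: measure_itvco_lty.
- move=> z; rewrite /F !normrM -[leRHS]mul1r; apply: ler_pM => //.
    by have /andP[i0 i1] := indic01 W z.1; rewrite ger0_norm.
  by rewrite -[leRHS]mul1r; apply: ler_pM => //; exact: osc_le1.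
- by move=> x y nW; rewrite /F /= indicE memNset// mul0r.
- move=> x y nc; rewrite /F /= (_ : osc S Y h n y = 0) ?mul0r ?mulr0//.
  apply/eqP; rewrite -normr_le0; apply: (le_trans (osc_bound Y n mS h0 y)).
  by rewrite indicE memNset.
Qed.

Lemma bfun_correlation : bfun mu (fun x => \1_W x * correlation S T Y h n lam s t x).
Proof. by under eq_fun do rewrite FE; have [] := F_swap. Qed.

Lemma correlation_le x : `|correlation S T Y h n lam s t x| <= n%:R * h.
Proof.
have -> : n%:R * h = 1 * fine (mu ((fun y : R => (y + arc lam s x)%R) @^-1` c)).
  rewrite lebesgue_measure_shift; last exact: measurable_itv.
  rewrite -/(length c) length_itvco; first by ring.
  by rewrite lerDl mulr_ge0// ltW.
have mc : measurable ((fun y : R => (y + arc lam s x)%R) @^-1` c).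
  rewrite -[X in measurable X]setTI; apply: measurable_funD => //.
  exact: measurable_itv.
apply: (@normr_int_le _ (measurableTypeR R)) => //.
- by apply: measurable_funM; apply: measurableT_comp;
    (exact: mosc||exact: measurable_funD).
- apply: (@le_lt_trans _ _ (mu c)); last exact: measure_itvco_lty.
  by rewrite le_eqVlt; apply/orP; left; apply/eqP; apply: lebesgue_measure_shift;
    exact: measurable_itv.
- by move=> y; rewrite normrM -[leRHS]mul1r; apply: ler_pM => //; exact: osc_le1.
- move=> y nc; rewrite (_ : osc S Y h n _ = 0) ?mul0r//.
  apply/eqP; rewrite -normr_le0; apply: (le_trans (osc_bound Y n mS h0 _)).
  by rewrite indicE memNset.
Qed.

(** After exchanging the integrals, the inner one over [x] is the average treated by [osc_equi_arc],
    uniformly in [y]; the outer one runs over an interval of length [n * h]. *)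
Lemma int_correlation_le sigma : 0 < lam -> lam = 2 * w -> 0 < sigma ->
  a <= s -> s + sigma <= t -> t <= a + w ->
  `|\int[mu]_x (\1_W x * correlation S T Y h n lam s t x)| <=
     n%:R * h * (h / (sigma / lam) ^+ 2 + 2 * (h / (sigma / lam))).
Proof.
move=> lam0 lamw sigma0 as_ st taw; under eq_Rintegral do rewrite FE.
have [_ [mG _] ->] := F_swap; rewrite mulrC.
set Th := (X in _ <= X * _).
have -> : n%:R * h = fine (mu c).
  rewrite -/(length c) length_itvco; first by ring.
  by rewrite lerDl mulr_ge0// ltW.
have GE y : \int[mu]_x F (x, y) = osc S Y h n y *
    \int[mu]_x (\1_W x * osc T Y h n (y + (arc lam t x - arc lam s x))).
  rewrite -intZ; last first.
    split.
      apply: measurable_funM; first by apply: measurable_indic; exact: measurable_itv.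
      apply: measurableT_comp; first exact: mosc.
      apply: measurable_funD => //; apply: measurable_funB;
        apply: continuous_measurable_fun; exact: continuous_arc.
    exists 1, W; split; [exact: measurable_itv|exact: measure_itvco_lty| |].
      move=> x; rewrite normrM -[leRHS]mul1r; apply: ler_pM => //; last exact: osc_le1.
      by have /andP[i0 i1] := indic01 W x; rewrite ger0_norm.
    by move=> x nW; rewrite indicE memNset// mul0r.
  by apply: eq_Rintegral => x _; rewrite /F /= mulrCA.
apply: (@normr_int_le _ (measurableTypeR R)) => //.
- exact: measurable_itv.
- exact: measure_itvco_lty.
- move=> y; rewrite GE normrM -[leRHS]mul1r; apply: ler_pM => //.
    exact: osc_le1.
  exact: (osc_equi_arc lam0 lamw sigma0 as_ st taw).
- move=> y nc; rewrite GE (_ : osc S Y h n y = 0) ?mul0r//.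
  apply/eqP; rewrite -normr_le0; apply: (le_trans (osc_bound Y n mS h0 y)).
  by rewrite indicE memNset.
Qed.

End Correlation.
End CellLemma.


(** * A prescribed distance inside one good cell *)

Section CellDistance.
Context (R : realType).
Local Notation mu := (@lebesgue_measure R).

(** The energy of the sum of the shifted oscillations is integrated over the window. Avoidance
    bounds it below through the abscissae in [G]; expansion into correlations bounds it above by [N]
    diagonal terms and fewer than [N ^+ 2] small ones. The last hypothesis makes these bounds
    incompatible. *)
Lemma cell_distance (E : R -> set R) (G : set R) (a w lam Y h s eta gam sigma : R)
    (n N : nat) :
  let H := n%:R * h in let W := `[a, a + w[%classic in
  let c := `[Y, Y + H[%classic in
  (0 < N)%N -> 0 < lam -> lam = 2 * w -> 0 < h -> 0 < eta <= 1 -> 0 < s -> 0 < sigma ->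
  measurable G -> G `<=` W -> gam * w <= length G ->
  2 * N%:R * sigma < gam * w ->
  (forall x, measurable (E x)) ->
  (forall x, G x -> eta * H <= length (E x `&` c)) ->
  (forall x, G x ->
    \sum_(k < n) (ratio (E x) Y h k - length (E x `&` c) / H) ^+ 2 <= s ^+ 2 * n%:R) ->
  lam + s * H <= eta ^+ 2 * H / 4 ->
  H * (N%:R * w + N%:R ^+ 2 * (h / (sigma / lam) ^+ 2 + 2 * (h / (sigma / lam)))) <
    gam * w * (N%:R ^+ 2 * eta ^+ 3 * H / 2) ->
  exists x x' y, [/\ `|x - x'| <= lam / 2, E x y & E x' (y + arc lam x' x)].
Proof.
move=> H W c N0 lam0 lamw h0 eta01 s0 sg0 mG GW lG sG mE EG oG small contra.
have w0 : 0 < w by lra.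
have eta0 : 0 < eta by case/andP: eta01.
have mW : measurable W by exact: measurable_itv.
have Woo : (mu W < +oo)%E by exact: measure_itvco_lty.
have Goo := sub_lty mG mW GW Woo.
have [p [pG ps]] := separated_points mG Goo (ltW sg0) (lt_le_trans sG lG).
pose P (i : 'I_N) := p i.
have PG i : G (P i) by exact: pG.
have WP x : W x -> a <= x /\ x < a + w.
  by rewrite /W /= in_itv /= => /andP.
have PW i := WP _ (GW _ (PG i)).
have dist x i : W x -> `|x - P i| <= lam / 2.
  move=> /WP [? ?]; have [? ?] := PW i.
  by rewrite ler_norml; apply/andP; split; lra.
apply: contrapT => none.
pose Th := h / (sigma / lam) ^+ 2 + 2 * (h / (sigma / lam)).
pose Cor i j := correlation (E (P i)) (E (P j)) Y h n lam (P i) (P j).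
have bC i j : bfun mu (fun x => \1_W x * Cor i j x) by exact: bfun_correlation.
have H0 : 0 <= H by rewrite mulr_ge0// ltW.
have Th0 : 0 <= Th.
  have q0 : 0 <= sigma / lam by apply: divr_ge0; exact: ltW.
  apply: addr_ge0; first by apply: divr_ge0; [exact: ltW|exact: sqr_ge0].
  by apply: mulr_ge0 => //; apply: divr_ge0 => //; exact: ltW.
have Cdiag i : `|\int[mu]_x (\1_W x * Cor i i x)| <= w * H.
  have lW : fine (mu W) = w.
    by rewrite -/(length W) length_itvco; [ring|rewrite lerDl ltW].
  rewrite -[X in X * H]lW mulrC; apply: (@normr_int_le _ (measurableTypeR R)) => //.
  - by case: (bC i i).
  - move=> x; rewrite normrM -[leRHS]mul1r; apply: ler_pM => //.
      by rewrite indicE; case: (x \in W); rewrite /= ?normr1 ?normr0.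
    exact: correlation_le.
  - by move=> x nW; rewrite indicE memNset// mul0r.
have Coff i j : i != j -> `|\int[mu]_x (\1_W x * Cor i j x)| <= H * Th.
  move=> ij; have [? ?] := PW i; have [? ?] := PW j.
  have sep : sigma <= `|P i - P j| by apply: ps.
  have [Pij|Pji] := leP (P i) (P j).
    apply: int_correlation_le => //; last by apply: ltW.
    by move: sep; rewrite distrC ger0_norm ?subr_ge0//; lra.
  under eq_Rintegral do rewrite /Cor correlationC.
  apply: int_correlation_le => //; last by apply: ltW.
  by move: sep; rewrite ger0_norm ?subr_ge0 ?(ltW Pji)//; lra.
pose Z x := \int[mu]_y (\sum_i osc (E (P i)) Y h n (y + arc lam (P i) x)) ^+ 2.
have ZE x : Z x = \sum_i \sum_j Cor i j x.
  rewrite /Z /Cor /correlation.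
  have bO i j : bfun mu (fun y => osc (E (P i)) Y h n (y + arc lam (P i) x) *
      osc (E (P j)) Y h n (y + arc lam (P j) x)).
    by apply: bfunM; apply: bfun_shift; exact: bfun_osc.
  transitivity (\int[mu]_y (\sum_i \sum_j (osc (E (P i)) Y h n (y + arc lam (P i) x) *
      osc (E (P j)) Y h n (y + arc lam (P j) x)))).
    apply: eq_Rintegral => y _; rewrite expr2 mulr_suml.
    by apply: eq_bigr => i _; rewrite mulr_sumr.
  rewrite int_sum; last by move=> i; exact: bfun_sum.
  by apply: eq_bigr => i _; rewrite int_sum.
have Z0 x : 0 <= Z x by apply: Rintegral_ge0 => y _; exact: sqr_ge0.
pose M := N%:R ^+ 2 * eta ^+ 3 * H / 2.
have M0 : 0 <= M.
  by rewrite divr_ge0// mulr_ge0// mulr_ge0 ?exprn_ge0// ltW.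
have ZG x : G x -> M <= Z x.
  move=> Gx; have Wx := GW _ Gx.
  apply: (@column_energy _ N n (E x `&` c) (fun i => E (P i)) (fun i => arc lam (P i) x)
    Y h eta lam s) => //.
  - by apply: measurableI => //; exact: measurable_itv.
  - exact: (EG _ Gx).
  - by move=> i; exact: (EG _ (PG i)).
  - by move=> i; exact: (oG _ (PG i)).
  - move=> i; have [_ /andP[h1 h2] _] := arc_bounds lam0 (dist x i Wx).
    by rewrite h2 andbT; lra.
  - move=> i y [Exy _] Ei; apply: none; exists x, (P i), y; split => //.
    exact: dist.
have bWZ : bfun mu (fun x => \1_W x * Z x).
  under eq_fun do rewrite ZE mulr_sumr.
  apply: bfun_sum => i; under eq_fun do rewrite mulr_sumr.
  exact: bfun_sum.
have low : gam * w * M <= \int[mu]_x (\1_W x * Z x).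
  apply: (@le_trans _ _ (M * length G)).
    by rewrite mulrC; apply: ler_wpM2l.
  have bG : bfun mu (\1_G : R -> R) by exact: bfun_indic.
  rewrite /length -int_indic// -intZ//; apply: le_int => //; first exact: bfunZ.
  move=> x; rewrite [\1_G x]indicE; have [/set_mem Gx|_] := boolP (x \in G).
    by rewrite mulr1 indicE mem_set ?mul1r; [exact: ZG|exact: GW].
  by rewrite mulr0 mulr_ge0// indicE.
have up : \int[mu]_x (\1_W x * Z x) <= N%:R * (w * H) + N%:R ^+ 2 * (H * Th).
  have -> : \int[mu]_x (\1_W x * Z x) = \sum_i \sum_j \int[mu]_x (\1_W x * Cor i j x).
    transitivity (\int[mu]_x (\sum_i \sum_j (\1_W x * Cor i j x))).
      apply: eq_Rintegral => x _; rewrite ZE mulr_sumr.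
      by apply: eq_bigr => i _; rewrite mulr_sumr.
    rewrite int_sum; last by move=> i; exact: bfun_sum.
    by apply: eq_bigr => i _; rewrite int_sum.
  apply: (@le_trans _ _ (\sum_(i < N) (w * H + N%:R * (H * Th)))).
    apply: ler_sum => i _; rewrite (bigD1 i) //=.
    apply: lerD; first by apply: le_trans (Cdiag i); exact: ler_norm.
    apply: (@le_trans _ _ (\sum_(j < N | j != i) (H * Th))).
      apply: ler_sum => j ji; apply: le_trans (Coff i j _); first exact: ler_norm.
      by rewrite eq_sym.
    apply: (@le_trans _ _ (\sum_(j < N) (H * Th))).
      by rewrite [leRHS](bigD1 i) //= lerDr mulr_ge0.
    by rewrite sumr_const card_ord mulr_natl.
  rewrite sumr_const card_ord -[X in X <= _]mulr_natl le_eqVlt.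
  by apply/orP; left; apply/eqP; move: (H * Th) (w * H) => u v; ring.
have : gam * w * M < gam * w * M.
  apply: le_lt_trans (le_trans low up) _.
  have -> : N%:R * (w * H) + N%:R ^+ 2 * (H * Th) =
      H * (N%:R * w + N%:R ^+ 2 * Th) by ring.
  exact: contra.
by rewrite ltxx.
Qed.

End CellDistance.


(** * Variance across scales and energy increments *)

Section Energy.
Context (R : realType).
Local Notation mu := (@lebesgue_measure R).

Lemma sum_mul_nat (f : nat -> R) K q :
  \sum_(m < K * q) f m = \sum_(k < K) \sum_(i < q) f (k * q + i)%N.
Proof.
elim: K => [|K IH]; first by rewrite mul0n !big_ord0.
rewrite big_ord_recr /= -IH mulSn addnC -(big_mkord xpredT f).
rewrite (@big_cat_nat _ _ _ (K * q)%N) //=; last exact: leq_addr.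
rewrite big_mkord; congr (_ + _).
rewrite -{1}[(K * q)%N]add0n big_addn addKn big_mkord.
by apply: eq_bigr => i _; rewrite addnC.
Qed.

Lemma cell_refine (Y h : R) q k i :
  cell (Y + k%:R * (q%:R * h)) h i = cell Y h (k * q + i)%N.
Proof.
by rewrite /cell -addnS !natrD !natrM !mulrDl !addrA !mulrA.
Qed.

(** Not divided by [q]: this is [q] times the variance of the densities of the [q] small cells in
    the [k]-th large one. *)
Definition variance (S : set R) (Y h : R) (q k : nat) : R :=
  let Y' := Y + k%:R * (q%:R * h) in
  \sum_(i < q) (ratio S Y' h i -
    length (S `&` `[Y', Y' + q%:R * h[%classic) / (q%:R * h)) ^+ 2.

Lemma cell_itv (Y h : R) k : cell Y h k = `[Y + k%:R * h, Y + k%:R * h + h[%classic.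
Proof. by rewrite /cell -natr1 mulrDl mul1r addrA. Qed.

Lemma varianceE (S : set R) (Y h : R) (q k : nat) : measurable S -> 0 < h -> (0 < q)%N ->
  variance S Y h q k = \sum_(i < q) ratio S Y h (k * q + i) ^+ 2 -
    q%:R * ratio S Y (q%:R * h) k ^+ 2.
Proof.
move=> mS h0 q0; have qr : 0 < q%:R :> R by rewrite ltr0n.
rewrite /variance /= -cell_itv -/(ratio S Y (q%:R * h) k).
set phi := ratio S Y (q%:R * h) k.
have sr : \sum_(i < q) ratio S (Y + k%:R * (q%:R * h)) h i = q%:R * phi.
  rewrite sum_ratio// -cell_itv /phi /ratio; field.
  by rewrite !gt_eqF.
rewrite (eq_bigr (fun i : 'I_q => ratio S (Y + k%:R * (q%:R * h)) h i ^+ 2 +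
    (- (2 * phi) * ratio S (Y + k%:R * (q%:R * h)) h i + phi ^+ 2))); last first.
  by move=> i _; ring.
rewrite big_split big_split /= -mulr_sumr sr sumr_const card_ord.
have -> : - (2 * phi) * (q%:R * phi) + phi ^+ 2 *+ q = - (q%:R * phi ^+ 2).
  by rewrite -mulr_natl; ring.
by congr (_ - _); apply: eq_bigr => i _; rewrite /ratio cell_refine.
Qed.

Lemma variance_ge0 S Y h q k : 0 <= variance S Y h q k.
Proof. by apply: sumr_ge0 => i _; exact: sqr_ge0. Qed.

(** The squared L^2 norm of the conditional expectation of the indicator of [S] on the cells of
    length [h]; by Pythagoras it increases under refinement by exactly the variances. *)
Definition energy (S : set R) (Y h : R) (K : nat) : R :=
  \sum_(k < K) h * ratio S Y h k ^+ 2.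

Lemma sum_variance (S : set R) (Y h : R) (q K : nat) :
  measurable S -> 0 < h -> (0 < q)%N ->
  \sum_(k < K) h * variance S Y h q k =
    energy S Y h (K * q) - energy S Y (q%:R * h) K.
Proof.
move=> mS h0 q0; rewrite /energy (sum_mul_nat (fun m => h * ratio S Y h m ^+ 2)) -sumrB.
apply: eq_bigr => k _; rewrite varianceE// mulrBr mulr_sumr; congr (_ - _).
by rewrite mulrA [h * _]mulrC.
Qed.

Lemma energy_ge0 S Y h K : 0 <= h -> 0 <= energy S Y h K.
Proof. by move=> h0; apply: sumr_ge0 => i _; rewrite mulr_ge0// sqr_ge0. Qed.

Lemma energy_le S Y h K : measurable S -> 0 < h ->
  energy S Y h K <= length (S `&` `[Y, Y + K%:R * h[%classic).
Proof.
move=> mS h0; rewrite -[leRHS](@divfK _ h) ?gt_eqF// -sum_ratio// mulr_suml.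
apply: ler_sum => k _; rewrite mulrC; apply: ler_wpM2r; first exact: ltW.
rewrite expr2 -[leRHS]mulr1; apply: ler_wpM2l; last exact: ratio_le1.
by apply: ratio_ge0; exact: ltW.
Qed.

(* Energies of successive scales telescope, so the total variance over all the
   scales is bounded independently of their number. *)
Lemma sum_variance_scales (S : set R) (Y : R) (l q K : nat -> nat) (J : nat) :
  measurable S -> (forall j, (0 < q j)%N) -> (forall j, (0 < l j)%N) ->
  (forall j, l j.+1 = (q j * l j)%N) ->
  (forall j, (j < J)%N -> K j = (K j.+1 * q j)%N) ->
  \sum_(j < J) \sum_(k < K j.+1) (l j)%:R * variance S Y (l j)%:R (q j) k <=
    length (S `&` `[Y, Y + (K 0%N)%:R * (l 0%N)%:R[%classic).
Proof.
move=> mS q0 l0 lq Kq.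
have lr j : 0 < (l j)%:R :> R by rewrite ltr0n.
suff -> : \sum_(j < J) \sum_(k < K j.+1) (l j)%:R * variance S Y (l j)%:R (q j) k =
    energy S Y (l 0%N)%:R (K 0%N) - energy S Y (l J)%:R (K J).
  have := energy_ge0 S Y (K J) (ltW (lr J)); have := @energy_le S Y _ (K 0%N) mS (lr 0%N).
  lra.
elim: J Kq => [|J IH] Kq; first by rewrite big_ord0 subrr.
rewrite big_ord_recr /= IH; last by move=> j jJ; apply: Kq; exact: ltnW.
by rewrite sum_variance// -natrM -lq -Kq//; ring.
Qed.

End Energy.


(** * Choice of a scale, a window and an interval *)

Section GoodCell.
Context (R : realType).
Local Notation mu := (@lebesgue_measure R).

Lemma multiple_between (u r : R) : 0 < u -> u <= r ->
  exists m : nat, (0 < m)%N /\ r < m%:R * u /\ m%:R * u <= 2 * r.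
Proof.
move=> u0 ur; exists (Num.trunc (r / u)).+1; split => //.
have ru : 0 <= r / u by rewrite divr_ge0 ?(ltW u0)// (le_trans (ltW u0)).
have /andP[t1 t2] := truncn_itv ru.
rewrite -ltr_pdivrMr//; split => //.
have : (Num.trunc (r / u))%:R * u <= r by rewrite -ler_pdivlMr.
by rewrite -natr1 mulrDl mul1r; lra.
Qed.

Section Square.
Variables (A : set (measurableTypeR R * measurableTypeR R)) (X0 Y0 r : R).
Hypotheses (mA : measurable A) (r0 : 0 < r).
Hypothesis Asub : A `<=` `[X0, X0 + r]%classic `*` `[Y0, Y0 + r]%classic.
Let E (x : R) : set R := xsection A x.
Let I : set R := `[X0, X0 + r]%classic.

Let mE x : measurable (E x). Proof. exact: measurable_xsection. Qed.

Let Esub x : E x `<=` `[Y0, Y0 + r]%classic.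
Proof. by move=> y; rewrite /E /xsection /= => /set_mem /Asub []. Qed.

Let Eout x : ~ I x -> E x = set0.
Proof.
move=> nI; apply/seteqP; split => // y; rewrite /E /xsection /= => /set_mem /Asub [].
by move=> ? _; exact: nI.
Qed.

Let itvcc_lty (u v : R) : (mu `[u, v]%classic < +oo)%E.
Proof. by rewrite lebesgue_measure_itv /=; case: ifP => _; rewrite ltry. Qed.

Let Eoo x : (mu (E x) < +oo)%E.
Proof. exact: (sub_lty (mE x) _ (@Esub x)). Qed.

Let bfun_length_section (C : set R) : measurable C ->
  bfun mu (fun x => length (E x `&` C)).
Proof.
move=> mC; have mAC : measurable (A `&` (setT `*` C)).
  by apply: measurableI => //; exact: measurableX.
have sE x : E x `&` C = xsection (A `&` (setT `*` C)) x.
  rewrite /E; apply/seteqP; split => y; rewrite /xsection /= !inE /=; first by case.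
  by case=> ? [].
split.
  apply: measurableT_comp; first exact: fine_measurable.
  under eq_fun do rewrite sE.
  exact: (measurable_fun_xsection mu mAC).
exists (length `[Y0, Y0 + r]%classic), I.
split; [exact: measurable_itv|exact: itvcc_lty| |].
- move=> x; rewrite ger0_norm ?length_ge0//; apply: length_le.
  + exact: measurableI.
  + exact: measurable_itv.
  + by move=> y [/Esub].
  + exact: itvcc_lty.
- by move=> x nI; rewrite Eout// set0I /length measure0.
Qed.

Let bfun_ratio h k : bfun mu (fun x => ratio (E x) Y0 h k).
Proof.
rewrite /ratio; under eq_fun do rewrite mulrC.
by apply: bfunZ; apply: bfun_length_section; exact: measurable_cell.
Qed.

Let bfun_variance (h : R) (q k : nat) : 0 < h -> (0 < q)%N ->
  bfun mu (fun x => variance (E x) Y0 h q k).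
Proof.
move=> h0 q0; under eq_fun do rewrite varianceE//.
apply: bfunB.
  by apply: bfun_sum => i; under eq_fun do rewrite expr2; apply: bfunM; exact: bfun_ratio.
by apply: bfunZ; under eq_fun do rewrite expr2; apply: bfunM; exact: bfun_ratio.
Qed.

Let blength : bfun mu (fun x => length (E x)).
Proof.
have := bfun_length_section (@measurableT _ (measurableTypeR R)).
by under eq_fun do rewrite setIT.
Qed.

(** The total variance of all scales is at most the measure [m] of [A], so some scale has at most
    [m / J]. At that scale a single averaged quantity, penalising both large variance and low
    density, yields one rectangle where most requirements hold at once. *)
Lemma good_cell (d s : R) (J : nat) (l q : nat -> nat) (w : nat -> R) :
  0 < d -> d * r ^+ 2 <= \int[mu]_x length (xsection A x) ->
  0 < s -> 4 <= s ^+ 2 * J%:R ->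
  (forall j, (0 < q j)%N) -> (forall j, (0 < l j)%N) ->
  (forall j, l j.+1 = (q j * l j)%N) -> (l J)%:R <= r ->
  (forall j, (j < J)%N -> 0 < w j <= r) ->
  exists j a Y, (j < J)%N /\ exists G : set R,
    let h : R := (l j)%:R in let H := (q j)%:R * h in
    [/\ measurable G, G `<=` `[a, a + w j[%classic, d / 8 * w j <= length G,
       forall x, G x -> d / 16 * H <= length (xsection A x `&` `[Y, Y + H[%classic) &
       forall x, G x -> \sum_(k < q j) (ratio (xsection A x) Y h k -
          length (xsection A x `&` `[Y, Y + H[%classic) / H) ^+ 2 <= s ^+ 2 * (q j)%:R].
Proof.
move=> d0 dm s0 sJ q0 l0 lq lJr wr.
set m := \int[mu]_x _ in dm.
have J0 : (0 < J)%N.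
  by rewrite lt0n; apply/negP => /eqP J0; move: sJ; rewrite J0 mulr0; lra.
have Jr : 0 < J%:R :> R by rewrite ltr0n.
have lr j : 0 < (l j)%:R :> R by rewrite ltr0n.
have qr j : 0 < (q j)%:R :> R by rewrite ltr0n.
have m0 : 0 < m by apply: lt_le_trans dm; rewrite mulr_gt0// exprn_gt0.
(* One interval, of length in []r, 2 * r]], is tiled by the cells of every scale, because each [l j]
   divides [l J]. It contains every column of [A]. *)
have [M [M0 [Mr M2r]]] := multiple_between (lr J) lJr.
have ldvd j : (j <= J)%N -> (l j %| l J)%N.
  elim: J {J0 Jr sJ lJr wr Mr M2r} => [|J IH]; first by rewrite leqn0 => /eqP ->.
  rewrite leq_eqVlt => /orP[/eqP -> //|jJ].
  by rewrite lq; apply: dvdn_mull; exact: IH.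
pose K j := (M * (l J %/ l j))%N.
have Kl j : (j <= J)%N -> (K j)%:R * (l j)%:R = M%:R * (l J)%:R :> R.
  by move=> jJ; rewrite -!natrM /K -mulnA divnK// ldvd.
have Kq j : (j < J)%N -> K j = (K j.+1 * q j)%N.
  move=> jJ; apply/eqP; rewrite -(eqn_pmul2r (l0 j)) -mulnA -lq /K -!mulnA.
  by rewrite !divnK// ldvd// ltnW.
have EK x : E x `&` `[Y0, Y0 + M%:R * (l J)%:R[%classic = E x.
  apply/setIidl => y /Esub; rewrite /= !in_itv /= => /andP[-> yr] /=.
  by apply: le_lt_trans yr _; rewrite ltrD2l.
pose V j k x := variance (E x) Y0 (l j)%:R (q j) k.
have bV j k : bfun mu (V j k) by exact: bfun_variance.
pose TV j := \int[mu]_x \sum_(k < K j.+1) (l j)%:R * V j k x.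
have bTV j : bfun mu (fun x => \sum_(k < K j.+1) (l j)%:R * V j k x).
  by apply: bfun_sum => k; exact: bfunZ.
have sTV : \sum_(j < J) TV j <= m.
  rewrite /TV -int_sum; last by move=> j; exact: bTV.
  apply: le_int => //; first by apply: bfun_sum => j; exact: bTV.
  by move=> x; have := sum_variance_scales Y0 (mE x) q0 l0 lq Kq; rewrite (Kl 0%N)// EK.
have [j jJ TVj] : exists2 j, (j < J)%N & J%:R * TV j <= m.
  apply: contrapT => H; have : \sum_(j < J) m / J%:R < \sum_(j < J) TV j.
    apply: ltr_sum => [|i _]; first by apply/hasP; exists (Ordinal J0); rewrite ?mem_index_enum.
    rewrite ltr_pdivrMr// mulrC ltNge; apply/negP => Hi; apply: H.
    by exists i.
  rewrite sumr_const card_ord -[m / _ *+ _]mulr_natl mulrC divfK ?gt_eqF//.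
  by rewrite ltNge sTV.
have /andP[w0 wle] := wr j jJ.
pose u := w j; pose h : R := (l j)%:R; pose H := (q j)%:R * h.
have h0 : 0 < h by exact: lr.
have H0 : 0 < H by rewrite mulr_gt0.
have HK : (K j.+1)%:R * H = M%:R * (l J)%:R by rewrite -(Kl j.+1)// lq natrM.
have [P [P0 [Pr P2r]]] := multiple_between w0 wle.
(* Mass of the column in the [k]-th interval, minus a penalty for variance and a threshold.
   Positivity of [T k x] alone gives both the density and the variance bound. *)
pose T k x := H * ratio (E x) Y0 H k - h / s ^+ 2 * V j k x - d / 16 * H.
have mT k : measurable_fun setT (T k).
  apply: measurable_funB => //; apply: measurable_funB; apply: measurable_funM => //.
    by case: (bfun_ratio H k).
  by case: (bV j k).
pose f k x := H * ratio (E x) Y0 H k - h / s ^+ 2 * V j k x.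
have bf k : bfun mu (f k).
  by apply: bfunB; apply: bfunZ; [exact: bfun_ratio|exact: bV].
have E0 k x : ~ I x -> f k x = 0.
  move=> nI; rewrite /f /V varianceE// big1 => [|i _]; rewrite /ratio Eout// set0I /length measure0 mul0r.
    by rewrite expr0n /= !mulr0 subrr mulr0 subrr.
  by rewrite expr0n.
pose Wp p := cell X0 u p.
have bW p : bfun mu (\1_(Wp p) : R -> R).
  by apply: bfun_indic; [exact: measurable_cell|exact: cell_lty].
have bWf p k : bfun mu (fun x => \1_(Wp p) x * f k x) by exact: bfunM.
have TE p k x : \1_(Wp p) x * T k x = \1_(Wp p) x * f k x - d / 16 * H * \1_(Wp p) x.
  by rewrite /T /f; ring.
have bWT p k : bfun mu (fun x => \1_(Wp p) x * T k x).
  by under eq_fun do rewrite TE; apply: bfunB => //; exact: bfunZ.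
have iW p : \int[mu]_x \1_(Wp p) x = u.
  rewrite int_indic; last exact: measurable_cell.
  by rewrite -/(length _) length_cell// ltW.
(* The mass contributes [m]; the variance penalty is at most [m / 4] since [4 <= s ^+ 2 * J], and
   the threshold at most [d / 16] times [(2 * r) ^+ 2], again at most [m / 4]. *)
have total : \sum_(k < K j.+1) \sum_(p < P) \int[mu]_x (\1_(Wp p) x * T k x) >= m / 2.
  have -> : \sum_(k < K j.+1) \sum_(p < P) \int[mu]_x (\1_(Wp p) x * T k x) =
      \sum_(k < K j.+1) (\int[mu]_x f k x - d / 16 * H * (P%:R * u)).
    apply: eq_bigr => k _.
    transitivity (\sum_(p < P) (\int[mu]_x (\1_(Wp p) x * f k x) - d / 16 * H * u)).
      apply: eq_bigr => p _.
      transitivity (\int[mu]_x (\1_(Wp p) x * f k x - d / 16 * H * \1_(Wp p) x)).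
        by apply: eq_Rintegral => x _; exact: TE.
      rewrite intB; [|exact: bWf|exact: bfunZ].
      by rewrite intZ; [rewrite iW|exact: bW].
    rewrite sumrB sumr_const card_ord -int_sum//; congr (_ - _).
      apply: eq_Rintegral => x _; rewrite -mulr_suml sum_cell ?(ltW w0)//.
      have [Ix|nI] := pselect (I x); last by rewrite E0// mulr0.
      rewrite indicE mem_set ?mul1r//; move: Ix; rewrite /I /= !in_itv /= => /andP[-> xr] /=.
      by apply: le_lt_trans xr _; rewrite ltrD2l.
    by rewrite -mulr_natl; ring.
  rewrite sumrB sumr_const card_ord -int_sum//.
  have -> : \int[mu]_x \sum_(k < K j.+1) f k x = m - (s ^+ 2)^-1 * TV j.
    rewrite /TV -intZ; last exact: bTV.
    rewrite -intB; [|exact: blength|apply: bfunZ; exact: bTV].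
    apply: eq_Rintegral => x _; rewrite /f sumrB; congr (_ - _).
      rewrite -mulr_sumr sum_ratio// HK EK mulrC divfK ?gt_eqF//.
    by rewrite mulr_sumr; apply: eq_bigr => k _; rewrite /h mulrA [h / _]mulrC.
  have s2 : 0 < s ^+ 2 by rewrite exprn_gt0.
  have h1 : (s ^+ 2)^-1 * TV j <= m / 4.
    rewrite mulrC ler_pdivrMr//.
    have TV0 : 0 <= TV j.
      apply: Rintegral_ge0 => x _; apply: sumr_ge0 => k _; apply: mulr_ge0; first exact: ltW.
      exact: variance_ge0.
    have := ler_wpM2l (ltW s2) TVj; have := ler_wpM2r TV0 sJ.
    by move: (TV j) (s ^+ 2) (J%:R) => *; lra.
  have h2 : (d / 16 * H * (P%:R * u)) *+ K j.+1 <= m / 4.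
    rewrite -mulr_natl (_ : _ * _ = d / 16 * (((K j.+1)%:R * H) * (P%:R * u))); last by ring.
    rewrite HK; have : M%:R * (l J)%:R * (P%:R * u) <= 2 * r * (2 * r).
      have u0 : 0 <= u by exact: ltW.
      by apply: ler_pM => //; exact: mulr_ge0.
    have d16 : 0 <= d / 16 by rewrite divr_ge0// ltW.
    move=> /(ler_wpM2l d16) /le_trans; apply.
    by rewrite (_ : d / 16 * _ = d * r ^+ 2 / 4); [lra|field].
  lra.
(* The rectangles have total area at most [(2 * r) ^+ 2], so one of them reaches the mean [d / 8]
   per unit area. *)
have [k [p big]] : exists k p, d / 8 * u * H <= \int[mu]_x (\1_(Wp p) x * T k x).
  apply: contrapT => nex.
  have : \sum_(k < K j.+1) \sum_(p < P) \int[mu]_x (\1_(Wp p) x * T k x) <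
      \sum_(k < K j.+1) \sum_(p < P) (d / 8 * u * H).
    have K0 : (0 < K j.+1)%N.
      rewrite -(ltr0n R) -(pmulr_lgt0 _ H0) HK.
      by rewrite mulr_gt0// ltr0n.
    apply: ltr_sum => [|k _].
      by apply/hasP; exists (Ordinal K0); rewrite ?mem_index_enum.
    apply: ltr_sum => [|p _].
      by apply/hasP; exists (Ordinal P0); rewrite ?mem_index_enum.
    by rewrite ltNge; apply/negP => hh; apply: nex; exists k, p.
  rewrite sumr_const sumr_const !card_ord; apply/negP; rewrite -leNgt.
  apply: le_trans total.
  rewrite -[_ *+ K _]mulr_natl -[_ *+ P]mulr_natl (_ : _ * _ = d / 8 * (((K j.+1)%:R * H) * (P%:R * u))); last by ring.
  rewrite HK; have : M%:R * (l J)%:R * (P%:R * u) <= 2 * r * (2 * r).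
    have u0 : 0 <= u by exact: ltW.
    by apply: ler_pM => //; exact: mulr_ge0.
  have d8 : 0 <= d / 8 by rewrite divr_ge0// ltW.
  move=> /(ler_wpM2l d8) /le_trans; apply.
  by rewrite (_ : d / 8 * _ = d * r ^+ 2 / 2); [lra|field].
pose Y := Y0 + k%:R * H.
(* Since [T k] is at most [H], the integral over the window bounds the length of this set from
   below. *)
pose G := Wp p `&` T k @^-1` `]0, +oo[%classic.
have mG : measurable G.
  apply: measurableI; first exact: measurable_cell.
  by rewrite -[X in measurable X]setTI; apply: mT => //; exact: measurable_itv.
have Wsub : Wp p = `[X0 + p%:R * u, X0 + p%:R * u + u[%classic by exact: cell_itv.
have GT x : G x -> 0 < T k x by case => _ /=; rewrite in_itv /= andbT.
have s2 : 0 < s ^+ 2 by rewrite exprn_gt0.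
have hs : 0 < h / s ^+ 2 by rewrite divr_gt0.
have lenE x : H * ratio (E x) Y0 H k = length (E x `&` `[Y, Y + H[%classic).
  by rewrite /ratio cell_itv mulrC divfK ?gt_eqF.
have V0 x : 0 <= V j k x by exact: variance_ge0.
have TH x : T k x <= H.
  have := ratio_le1 Y0 k (mE x) H0; move=> /(ler_wpM2l (ltW H0)).
  have : 0 <= h / s ^+ 2 * V j k x by apply: mulr_ge0 => //; exact: ltW.
  have : 0 <= d / 16 * H by apply: mulr_ge0; [rewrite divr_ge0// ltW|exact: ltW].
  rewrite /T mulr1; move: (V j k x) (ratio _ _ _ _) => v rr; lra.
exists j, (X0 + p%:R * u), Y; split => //; exists G; split => //.
- by rewrite -/u -Wsub; exact: subIsetl.
- have Goo : (mu G < +oo)%E.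
    apply: (sub_lty mG _ (@subIsetl _ _ _)); first exact: measurable_cell.
    exact: cell_lty.
  have bG : bfun mu (\1_G : R -> R) by exact: bfun_indic.
  have : \int[mu]_x (\1_(Wp p) x * T k x) <= H * length G.
    rewrite /length -int_indic// -intZ//; apply: le_int => //; first exact: bfunZ.
    move=> x; rewrite [\1_G x]indicE; have [/set_mem Gx|nG] := boolP (x \in G).
      by rewrite mulr1 indicE mem_set ?mul1r; [exact: TH|case: Gx].
    rewrite mulr0 indicE; have [/set_mem Wx|] := boolP (x \in _); last by rewrite mul0r.
    rewrite mul1r leNgt; apply/negP => Tx; move/negP: nG; apply; rewrite inE; split => //=.
    by rewrite in_itv /= Tx.
  move=> /(le_trans big); rewrite mulrC ler_pM2l//.
- move=> x Gx; apply: ltW; rewrite -subr_gt0; apply: lt_le_trans (GT x Gx) _.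
  rewrite /T lenE lerD2r lerBlDr lerDl.
  by apply: mulr_ge0 => //; exact: ltW.
- move=> x /GT; have := ratio_le1 Y0 k (mE x) H0; move=> /(ler_wpM2l (ltW H0)).
  have : 0 <= d / 16 * H by apply: mulr_ge0; [rewrite divr_ge0// ltW|exact: ltW].
  rewrite /T mulr1 => d16 r1 T0.
  have : h / s ^+ 2 * V j k x <= H by move: (V j k x) (ratio _ _ _ _) r1 T0 => v rr; lra.
  rewrite /H mulrAC ler_pdivrMr// [h * _]mulrC mulrAC ler_pM2r// mulrC.
  exact.
Qed.

End Square.
End GoodCell.


(** * Distances from an unbounded set in the plane *)

Section PlaneDistance.
Context (R : realType).
Local Notation mu := (@lebesgue_measure R).

Lemma nat_above (x : R) : exists2 n : nat, (0 < n)%N & x <= n%:R.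
Proof. by exists (Num.trunc x).+1 => //; apply/ltW; exact: truncnS_gt. Qed.

Lemma plane_distance (d : R) (VV : set R) : 0 < d ->
  (forall M, exists2 v, VV v & M <= v) ->
  exists2 R0 : R, 0 < R0 & forall r X0 Y0
    (A : set (measurableTypeR R * measurableTypeR R)), R0 <= r -> measurable A ->
    A `<=` `[X0, X0 + r]%classic `*` `[Y0, Y0 + r]%classic ->
    d * r ^+ 2 <= \int[mu]_x length (xsection A x) ->
    exists v x y x' y', [/\ VV v, 0 < v, A (x, y), A (x', y') &
      (x' - x) ^+ 2 + (y' - y) ^+ 2 = v ^+ 2].
Proof.
move=> dpos /(_ _)/cid2-/all_sig[pick /all_and2[pickV pickM]].
have [d1 [d10 d11 d1d]] : exists d1, [/\ 0 < d1, d1 <= 1 & d1 <= d].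
  by exists (Num.min d 1); split; rewrite ?lt_min ?dpos ?ltr01 ?ge_min ?lexx ?orbT.
(* These are the constants delivered by [good_cell]; the replacement of [d] by [d1 <= 1] ensures
   [eta <= 1]. *)
pose eta := d1 / 16; pose gam := d1 / 8.
have [eta0 eta1] : 0 < eta /\ eta <= 1 by rewrite /eta; split; lra.
have gam0 : 0 < gam by rewrite /gam; lra.
pose s := eta ^+ 2 / 16.
have eta20 : 0 < eta ^+ 2 by rewrite exprn_gt0.
have eta30 : 0 < eta ^+ 3 by rewrite exprn_gt0.
have s0 : 0 < s by rewrite divr_gt0.
have [J J0 HJ] := nat_above (4 / s ^+ 2).
(* With this [N] the diagonal correlations are at most a quarter of the energy forced by
   avoidance. *)
have [N N0 HN] := nat_above (8 / (gam * eta ^+ 3)).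
have Nr : 0 < N%:R :> R by rewrite ltr0n.
(* The ratio [sigma / lam] for the separation [sigma = gam * lam / (8 * N)]: it is the same at all
   scales, so the constants below can be fixed before the scales. *)
pose beta := gam / (8 * N%:R).
have beta0 : 0 < beta by rewrite divr_gt0// mulr_gt0.
pose c0 := (beta ^+ 2)^-1 + 2 / beta.
have c00 : 0 < c0 by apply: addr_gt0; [rewrite invr_gt0 exprn_gt0|apply: divr_gt0].
(* The condition [h <= e * lam] makes the off-diagonal correlations at most another quarter of the
   forced energy. *)
pose e := gam * eta ^+ 3 / (16 * c0).
have e0 : 0 < e by rewrite divr_gt0// ?mulr_gt0.
(* From a cell length [x]: a distance in [VV] that is large relative to [x], then a number of cells
   [qf x] making the next length at least [16 / eta ^+ 2] times that distance. *)
pose lamf (x : nat) := pick (Num.max (x%:R / e) 1).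
pose qf (x : nat) := (Num.trunc (16 * lamf x / eta ^+ 2)).+1.
pose l j := iter j (fun x => (qf x * x)%N) 1%N.
have l0 j : (0 < l j)%N by elim: j => //= j IH; rewrite muln_gt0.
pose lam j := lamf (l j).
have lam_ge j : (l j)%:R <= e * lam j /\ 1 <= lam j.
  have := pickM (Num.max ((l j)%:R / e) 1); rewrite ge_max => /andP[h1 h2].
  by split => //; rewrite mulrC -ler_pdivrMr.
have lam0 j : 0 < lam j by have [_] := lam_ge j; exact: lt_le_trans.
(* Large enough for the longest cell and every window of width [lam j / 2] to fit in the square. *)
exists ((l J)%:R + \sum_(j < J) lam j).
  by rewrite ltr_pwDl ?ltr0n// sumr_ge0// => j _; exact: ltW.
move=> r X0 Y0 A Rr mA Asub dA.
have sl0 : 0 <= \sum_(j < J) lam j by apply: sumr_ge0 => j _; exact: ltW.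
have lJ0 : 0 < (l J)%:R :> R by rewrite ltr0n.
have r0 : 0 < r by apply: lt_le_trans Rr; rewrite ltr_wpDr.
have lJr : (l J)%:R <= r by apply: le_trans Rr; rewrite lerDl.
have wr j : (j < J)%N -> 0 < lam j / 2 <= r.
  move=> jJ; apply/andP; split; first by rewrite divr_gt0.
  have : lam j <= \sum_(j < J) lam j.
    rewrite (bigD1 (Ordinal jJ)) //= lerDl; apply: sumr_ge0 => i _; exact: ltW.
  by have := lam0 j; lra.
have dA1 : d1 * r ^+ 2 <= \int[mu]_x length (xsection A x).
  by apply: le_trans dA; apply: ler_wpM2r => //; exact: sqr_ge0.
have sJ : 4 <= s ^+ 2 * J%:R by rewrite mulrC -ler_pdivrMr// exprn_gt0.
have [j [a [Y [jJ [G [mG GW lG GE GV]]]]]] :=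
  @good_cell R A X0 Y0 r mA r0 Asub d1 s J l (fun j => qf (l j)) (fun j => lam j / 2)
    d10 dA1 s0 sJ (fun j => ltn0Sn _) l0 (fun j => erefl _) lJr wr.
have h0 : 0 < (l j)%:R :> R by rewrite ltr0n.
have q0 : 0 < (qf (l j))%:R :> R by rewrite ltr0n.
have [hl _] := lam_ge j; have lj0 := lam0 j.
have lamH : 16 * lam j <= eta ^+ 2 * ((qf (l j))%:R * (l j)%:R).
  have h1 : 16 * lam j <= eta ^+ 2 * (qf (l j))%:R.
    by rewrite [leRHS]mulrC -ler_pdivrMr//; apply: ltW; exact: truncnS_gt.
  apply: (le_trans h1); rewrite mulrA; apply: ler_peMr.
    by apply: mulr_ge0; exact: ltW.
  by rewrite ler1n.
have sl : gam * lam j / (8 * N%:R) / lam j = beta.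
  by rewrite /beta; field; rewrite !gt_eqF.
have gw0 : 0 < gam * lam j by rewrite mulr_gt0.
have := @cell_distance R (xsection A) G a (lam j / 2) (lam j) Y (l j)%:R s eta gam
  (gam * lam j / (8 * N%:R)) (qf (l j)) N N0 lj0.
case=> //.
- by field.
- by rewrite eta0.
- by rewrite divr_gt0// mulr_gt0.
- have -> : 2 * N%:R * (gam * lam j / (8 * N%:R)) = gam * lam j / 4.
    by field; rewrite gt_eqF.
  lra.
- by move=> x; exact: measurable_xsection.
- by rewrite /s; move: lamH; move: (_%:R * _%:R) => H; lra.
- rewrite sl; set H := (qf _)%:R * _ in lamH *.
  have H0 : 0 < H by rewrite mulr_gt0.
  have hN : 8 <= N%:R * (gam * eta ^+ 3) by rewrite -ler_pdivrMr// mulr_gt0.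
  have hT : (l j)%:R / beta ^+ 2 + 2 * ((l j)%:R / beta) <= gam * eta ^+ 3 * lam j / 16.
    have -> : (l j)%:R / beta ^+ 2 + 2 * ((l j)%:R / beta) = (l j)%:R * c0.
      by rewrite /c0; ring.
    have := ler_wpM2r (ltW c00) hl; rewrite /e => /le_trans; apply.
    by rewrite le_eqVlt; apply/orP; left; apply/eqP; field; rewrite gt_eqF.
  rewrite mulrC [N%:R ^+ 2 * eta ^+ 3 * H / 2]mulrAC [ltRHS]mulrA ltr_pM2r//.
  set T := _ + 2 * _ in hT *.
  have N2 : 0 < N%:R ^+ 2 :> R by rewrite exprn_gt0.
  have p1 := ler_wpM2l (ltW N2) hT.
  have p2 := ler_wpM2r (_ : 0 <= N%:R * lam j / 16) hN.
  have {}p2 := p2 (divr_ge0 (mulr_ge0 (ltW Nr) (ltW lj0)) (ler0n _ _)).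
  have p3 : 0 < N%:R ^+ 2 * (gam * eta ^+ 3 * lam j).
    by rewrite !mulr_gt0.
  move: p1 p2 p3; clear hT; rewrite !expr2; move: (eta ^+ 3) T => e3 T; lra.
move=> x [x' [y [xx' Ay Ay']]].
have [_ _ D2] := arc_bounds lj0 xx'.
exists (lam j), x, y, x', (y + arc (lam j) x' x); split => //.
- exact: pickV.
- by move: Ay; rewrite /xsection /= inE.
- by move: Ay'; rewrite /xsection /= inE.
- by rewrite [y + _ - y]addrAC subrr add0r D2; ring.
Qed.

End PlaneDistance.


(** * Slices along the first coordinate, and cubes *)

Section Cons.
Context (R : realType) (n : nat).
Implicit Types (t : R) (y : 'rV[R]_n).

Lemma cons_rV_head t y : cons_rV (t, y) 0 ord0 = t.
Proof.
have e : row_mx (const_mx t) y 0 (lshift n (0 : 'I_1)) = t by rewrite row_mxEl mxE.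
by rewrite -[RHS]e; congr (fun_of_matrix _ _ _); exact/val_inj.
Qed.

Lemma cons_rV_tail t y j : cons_rV (t, y) 0 (lift ord0 j) = y 0 j.
Proof.
have e : row_mx (const_mx t) y 0 (rshift 1 j) = y 0 j by rewrite row_mxEr.
by rewrite -[RHS]e; congr (fun_of_matrix _ _ _); exact/val_inj.
Qed.

Let addmxE k (u v : 'rV[R]_k) i : (u + v) 0 i = u 0 i + v 0 i.
Proof. by rewrite mxE. Qed.

Lemma cons_rVD t y t' y' : cons_rV (t, y) + cons_rV (t', y') = cons_rV (t + t', y + y').
Proof.
apply/rowP => i; rewrite addmxE; case: (unliftP ord0 i) => [j|] ->.
  by rewrite !cons_rV_tail addmxE.
by rewrite !cons_rV_head.
Qed.

Lemma cons_rV0 : cons_rV (0 : R, 0 : 'rV[R]_n) = 0.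
Proof.
apply/rowP => i; rewrite [RHS]mxE; case: (unliftP ord0 i) => [j|] ->.
  by rewrite cons_rV_tail mxE.
by rewrite cons_rV_head.
Qed.

Lemma cons_rV_sum I (r : seq I) (P : pred I) (F : I -> 'rV[R]_n) :
  \sum_(i <- r | P i) cons_rV (0, F i) = cons_rV (0, \sum_(i <- r | P i) F i).
Proof.
elim: r => [|i r IH]; first by rewrite !big_nil cons_rV0.
by rewrite !big_cons; case: ifP => // _; rewrite IH cons_rVD addr0.
Qed.

Lemma dotv_cons t y t' y' :
  dotv (cons_rV (t, y)) (cons_rV (t', y')) = t * t' + dotv y y'.
Proof.
rewrite /dotv big_ord_recl !cons_rV_head; congr (_ + _).
by apply: eq_bigr => i _; rewrite !cons_rV_tail.
Qed.

Definition slice (A : set 'rV[R]_n.+1) t : set 'rV[R]_n := [set y | A (cons_rV (t, y))].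

Lemma slice_xsection A t : slice A t = xsection (@cons_rV R n @^-1` A) t.
Proof. by apply/seteqP; split => y; rewrite /slice /xsection /= inE. Qed.

Lemma measurable_cons_preimage (A : set 'rV[R]_n.+1) : measurable A ->
  measurable (@cons_rV R n @^-1` A).
Proof. by move=> mA; rewrite -[X in measurable X]setTI; exact: measurable_cons_rV. Qed.

Lemma measurable_slice (A : set 'rV[R]_n.+1) t : measurable A -> measurable (slice A t).
Proof.
by move=> mA; rewrite slice_xsection; apply: measurable_xsection;
  exact: measurable_cons_preimage.
Qed.

Lemma measurable_fun_slice (A : set 'rV[R]_n.+1) : measurable A ->
  measurable_fun [set: measurableTypeR R] (fun t => borel_lebesgue (slice A t)).
Proof.
move=> mA; under eq_fun do rewrite slice_xsection.
exact: (measurable_fun_xsection (@borel_lebesgue R n) (measurable_cons_preimage mA)).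
Qed.

Lemma borel_lebesgue_slice (A : set 'rV[R]_n.+1) :
  borel_lebesgue A = (\int[@lebesgue_measure R]_t borel_lebesgue (slice A t))%E.
Proof.
rewrite [LHS]/= /pushforward /product_measure1.
by apply: eq_integral => t _; rewrite slice_xsection.
Qed.

Definition behead_rV (x : 'rV[R]_n.+1) : 'rV[R]_n := \row_j x 0 (lift ord0 j).

Lemma slice_cube (A : set 'rV[R]_n.+1) x (r : R) t :
  A `<=` cube x r -> slice A t `<=` cube (behead_rV x) r.
Proof.
move=> Ax y /Ax h i; have := h (lift ord0 i).
by rewrite cons_rV_tail !mxE.
Qed.

Lemma slice_out (A : set 'rV[R]_n.+1) x (r : R) t :
  A `<=` cube x r -> ~ x 0 ord0 <= t <= x 0 ord0 + r -> slice A t = set0.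
Proof.
move=> Ax nt; apply/seteqP; split => // y /Ax /(_ ord0).
by rewrite cons_rV_head => /nt.
Qed.

End Cons.

Section Cube.
Context (R : realType) (n : nat).

Lemma measurable_cube (x : 'rV[R]_n) (r : R) : measurable (cube x r).
Proof.
rewrite (_ : cube x r = [set y | forall i, x 0 i <= y 0 i <= (x + const_mx r) 0 i]).
  exact: measurable_box_rV.
by apply/seteqP; split => y h i; have := h i; rewrite !mxE.
Qed.

Lemma borel_lebesgue_cube (x : 'rV[R]_n) (r : R) : 0 <= r ->
  borel_lebesgue (cube x r) = (r ^+ n)%:E.
Proof.
move=> r0.
rewrite (_ : cube x r = [set y | forall i, x 0 i <= y 0 i <= (x + const_mx r) 0 i]); last first.
  by apply/seteqP; split => y h i; have := h i; rewrite !mxE.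
rewrite borel_lebesgue_box => [|i]; last by rewrite !mxE lerDl.
congr EFin; rewrite (eq_bigr (fun=> r)) ?prodr_const ?card_ord// => i _.
by rewrite !mxE addrAC subrr add0r.
Qed.

Lemma borel_lebesgue_sub_cube (A : set 'rV[R]_n) x (r : R) : 0 <= r -> measurable A ->
  A `<=` cube x r -> (borel_lebesgue A <= (r ^+ n)%:E)%E.
Proof.
move=> r0 mA Ax; rewrite -(borel_lebesgue_cube x r0).
by apply: le_measure => //; rewrite inE//; exact: measurable_cube.
Qed.

End Cube.

(** * Boxes described by the supports of their edges *)

Section Boxes.
Context (R : realType).

(* The edge of index j lives on the coordinate j, except for the last edge,
   which lives on all the coordinates of index at least m - 1. *)
Definition coordinatewise m n (v : 'I_m -> 'rV[R]_n) :=
  forall j i, v j 0 i != 0 -> minn i m.-1 = j.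

Definition aligned_box m n (A : set 'rV[R]_n) (V : R) :=
  exists (p : 'rV[R]_n) (v : 'I_m -> 'rV[R]_n),
    [/\ forall j, v j != 0, coordinatewise v, box_volume v = V &
        forall T : {set 'I_m}, A (box_vertex p v T)].

(** Each coordinate [i] belongs to the single edge [minn i m.-1]. Distinct edges thus have disjoint
    supports, which gives orthogonality and both alignment conditions. *)
Lemma aligned_boxP m n (A : set 'rV[R]_n) (V : R) : (0 < m)%N ->
  aligned_box m A V -> exists (p : 'rV[R]_n) (v : 'I_m -> 'rV[R]_n),
    [/\ box_edges v, edges_aligned v, box_volume v = V &
        forall T : {set 'I_m}, A (box_vertex p v T)].
Proof.
move=> m0 [p [v [v0 cv vV vA]]]; exists p, v; split => //.
  split => // i j ij; rewrite /dotv big1// => k _.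
  have [->|vik] := eqVneq (v i 0 k) 0; first by rewrite mul0r.
  have [->|vjk] := eqVneq (v j 0 k) 0; first by rewrite mulr0.
  by move: ij; rewrite -(inj_eq val_inj) /= -(cv _ _ vik) -(cv _ _ vjk) eqxx.
split.
  move=> j i jm ij; exists (v j 0 i); apply/rowP => k; rewrite !mxE eqxx /=.
  have [->|ki] := eqVneq k i; first by rewrite mulr1.
  rewrite mulr0; apply/eqP; apply: contraT => /cv kj.
  move: ki; rewrite -(inj_eq val_inj) /= ij; move: kj jm; rewrite /minn.
  by case: ltnP => [_ ->|_ ->]; rewrite ?eqxx ?ltnn.
move=> j jm; rewrite [v j]row_sum_delta; apply: summx_sub => i _.
have [->|vji] := eqVneq (v j 0 i) 0; first by rewrite scale0r sub0mx.
apply: scalemx_sub; apply: (sumsmx_sup i); last by rewrite genmxE.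
by rewrite -jm -(cv _ _ vji) geq_minl.
Qed.

(** The uniformity of [R0] in [A] and [x] is what the induction uses. The set [VV] will be the set
    of volumes missed by [A]. *)
Definition contains_boxes m n := forall (d : R) (VV : set R), 0 < d ->
  (forall M, exists2 V, VV V & M <= V) ->
  exists2 R0 : R, 0 < R0 & forall r (x : 'rV[R]_n) (A : set 'rV[R]_n),
    R0 <= r -> measurable A -> A `<=` cube x r ->
    ((d * r ^+ n)%:E <= borel_lebesgue A)%E ->
    exists V, [/\ VV V, 0 < V & aligned_box m A V].

End Boxes.


(** * Overlapping sets, and sums of translated slices *)

Section Bonferroni.
Context d (T : measurableType d) (R : realType) (mu : {measure set T -> \bar R}).

(** Pointwise: if [M] of the sets contain [x], the ordered pairs number [S = M ^+ 2 - M], and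
    [(M - 1) ^+ 2 >= 0] gives [M <= 1 + S]. *)
Lemma bonferroni (k : nat) (B : 'I_k -> set T) (C : set T) :
  measurable C -> (mu C < +oo)%E -> (forall a, measurable (B a)) ->
  (forall a, B a `<=` C) ->
  \sum_a fine (mu (B a)) <= fine (mu C) +
    \sum_a \sum_(b | b != a) fine (mu (B a `&` B b)).
Proof.
move=> mC Coo mB BC.
have Boo (D : set T) : measurable D -> D `<=` C -> (mu D < +oo)%E.
  by move=> mD DC; apply: le_lt_trans Coo; apply: le_measure => //; rewrite inE.
have mBI a b : measurable (B a `&` B b) by exact: measurableI.
have bB a : bfun mu (\1_(B a) : T -> R) by apply: bfun_indic => //; exact: Boo.
have bBI a b : bfun mu (\1_(B a `&` B b) : T -> R).
  by apply: bfun_indic => //; apply: Boo => // x [/BC].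
have bC : bfun mu (\1_C : T -> R) by exact: bfun_indic.
have bS : bfun mu (fun x => \sum_a \sum_(b | b != a) \1_(B a `&` B b) x : R).
  by apply: bfun_sum => a; exact: bfun_sum.
have -> : \sum_a fine (mu (B a)) = \int[mu]_x \sum_a \1_(B a) x.
  by rewrite int_sum//; apply: eq_bigr => a _; rewrite int_indic.
have -> : \sum_a \sum_(b | b != a) fine (mu (B a `&` B b)) =
    \int[mu]_x \sum_a \sum_(b | b != a) \1_(B a `&` B b) x.
  rewrite int_sum; last by move=> a; exact: bfun_sum.
  by apply: eq_bigr => a _; rewrite int_sum//; apply: eq_bigr => b _; rewrite int_indic.
rewrite -int_indic// -intD//; apply: le_int; first exact: bfun_sum.
  exact: bfunD.
move=> x; pose M : R := \sum_a \1_(B a) x.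
pose S : R := \sum_a \sum_(b | b != a) \1_(B a `&` B b) x.
rewrite -/M -/S.
have SE : M ^+ 2 = M + S.
  rewrite expr2 {1}/M mulr_suml /M /S -big_split; apply: eq_bigr => a _ /=.
  rewrite (bigD1 a) //= mulrDr; congr (_ + _).
    by rewrite indicE; case: (x \in B a); rewrite ?mulr1 ?mulr0.
  rewrite mulr_sumr; apply: eq_bigr => b _.
  by rewrite !indicE in_setI -mulnb natrM.
have [Cx|nC] := pselect (C x).
  rewrite indicE mem_set//=; have := sqr_ge0 (M - 1).
  by rewrite sqrrB1 SE -mulr_natl; lra.
have -> : M = 0.
  by apply: big1 => a _; rewrite indicE memNset// => /BC.
apply: addr_ge0; first by rewrite indicE.
by apply: sumr_ge0 => a _; apply: sumr_ge0 => b _; rewrite indicE.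
Qed.

End Bonferroni.

Section Slices.
Context (R : realType) (n : nat).
Local Notation mu := (@lebesgue_measure R).

Definition vol k (E : set 'rV[R]_k) : R := fine (borel_lebesgue E).

Lemma EFin_vol k (A : set 'rV[R]_k) x (r : R) : 0 <= r -> measurable A ->
  A `<=` cube x r -> (vol A)%:E = borel_lebesgue A.
Proof.
move=> r0 mA Ax; rewrite fineK// ge0_fin_numE//.
by apply: le_lt_trans (borel_lebesgue_sub_cube r0 mA Ax) _; rewrite ltry.
Qed.

Lemma vol_le_cube k (A : set 'rV[R]_k) x (r : R) : 0 <= r -> measurable A ->
  A `<=` cube x r -> vol A <= r ^+ k.
Proof.
move=> r0 mA Ax; rewrite -lee_fin (EFin_vol r0 mA Ax).
exact: borel_lebesgue_sub_cube Ax.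
Qed.

Variables (A : set 'rV[R]_n.+1) (x : 'rV[R]_n.+1) (r : R).
Hypotheses (r0 : 0 <= r) (mA : measurable A) (Ax : A `<=` cube x r).
Let I : set R := `[x 0 ord0, x 0 ord0 + r]%classic.

Let itvcc_lty (u v : R) : (mu `[u, v]%classic < +oo)%E.
Proof. by rewrite lebesgue_measure_itv /=; case: ifP => _; rewrite ltry. Qed.

Lemma vol_slice_out t : ~ x 0 ord0 <= t <= x 0 ord0 + r -> vol (slice A t) = 0.
Proof. by move=> nI; rewrite /vol (slice_out Ax nI) measure0. Qed.

Lemma bfun_slice : bfun mu (fun t => vol (slice A t)).
Proof.
split.
  apply: measurableT_comp; first exact: fine_measurable.
  exact: measurable_fun_slice.
exists (r ^+ n), I; split; [exact: measurable_itv| | |].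
- exact: itvcc_lty.
- move=> t; rewrite ger0_norm ?fine_ge0//.
  by apply: (vol_le_cube r0 _ (slice_cube Ax)); exact: measurable_slice.
- by move=> t nI; apply: vol_slice_out; move: nI; rewrite /I /= in_itv.
Qed.

Lemma int_slice : \int[mu]_t vol (slice A t) = vol A.
Proof.
rewrite /Rintegral /vol borel_lebesgue_slice; congr fine.
apply: eq_integral => t _.
by rewrite (EFin_vol r0 _ (slice_cube Ax))//; exact: measurable_slice.
Qed.

(** The sum integrates over [t] to [k * vol A] and vanishes outside an interval of length
    [r + k + 1 <= 3 * r]. A factor [d / 3] would be the mean; [d / 4] makes the contradiction
    strict. *)
Lemma shifted_slices_large (d : R) (k : nat) : (0 < k)%N -> 1 <= r -> k%:R <= r ->
  0 < d -> d * r ^+ n.+1 <= vol A ->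
  exists t, k%:R * (d / 4) * r ^+ n <= \sum_(a < k) vol (slice A (t + a%:R)).
Proof.
move=> k0 r1 kr d0 dA; have rr : 0 < r by exact: lt_le_trans r1.
have krr : 0 < k%:R :> R by rewrite ltr0n.
apply: contrapT => H.
have bs a : bfun mu (fun t => vol (slice A (t + a%:R))).
  exact: (bfun_shift a%:R bfun_slice).
pose c := k%:R * (d / 4) * r ^+ n.
have c0 : 0 < c by rewrite !mulr_gt0 ?exprn_gt0// divr_gt0.
have : k%:R * vol A <= c * (r + k%:R + 1).
  have -> : k%:R * vol A = \int[mu]_t \sum_(a < k) vol (slice A (t + a%:R)).
    rewrite int_sum; last by move=> a; exact: bs.
    rewrite (eq_bigr (fun=> vol A)) ?sumr_const ?card_ord ?mulr_natl// => a _.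
    by rewrite (int_shift a%:R bfun_slice) int_slice.
  have -> : r + k%:R + 1 = \int[mu]_t \1_(`[x 0 ord0 - k%:R, x 0 ord0 + r + 1[%classic) t.
    by rewrite int_itv; [ring|lra].
  rewrite -intZ; last exact: bfun_itv.
  apply: le_int; first by apply: bfun_sum => a; exact: bs.
    by apply: bfunZ; exact: bfun_itv.
  move=> t; rewrite indicE mem_setE in_itv /=.
  have [/andP[t1 t2]|nt] := boolP (_ && _).
    by rewrite mulr1 leNgt; apply/negP => ?; apply: H; exists t; exact: ltW.
  rewrite mulr0 big1// => a _; apply: vol_slice_out => /andP[h1 h2].
  move/negP: nt; apply; apply/andP.
  have ak : a%:R <= k%:R :> R by rewrite ler_nat ltnW.
  have a0 : 0 <= a%:R :> R by [].
  by split; lra.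
apply/negP; rewrite -ltNge.
apply: (@lt_le_trans _ _ (k%:R * (d * r ^+ n.+1))); last by apply: ler_wpM2l => //; exact: ltW.
apply: (@le_lt_trans _ _ (c * (3 * r))).
  by apply: ler_wpM2l; [exact: ltW|lra].
have -> : c * (3 * r) = k%:R * (3 / 4 * (d * r ^+ n.+1)) by rewrite /c exprS; field.
rewrite ltr_pM2l// gtr_pMl; first lra.
by rewrite mulr_gt0// exprn_gt0.
Qed.

End Slices.


(** * Raising the dimensions *)

Section Induction.
Context (R : realType).

Lemma enorm_cons_tail n (y : 'rV[R]_n) : enorm (cons_rV (0, y)) = enorm y.
Proof. by rewrite /enorm dotv_cons mul0r add0r. Qed.

Lemma enorm_cons_head n (c : R) : 0 <= c -> enorm (cons_rV (c, 0 : 'rV[R]_n)) = c.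
Proof.
move=> c0; rewrite /enorm dotv_cons /dotv big1 => [|i _]; last by rewrite mxE mul0r.
by rewrite addr0 -expr2 sqrtr_sqr ger0_norm.
Qed.

Lemma cons_rV_tail_neq0 n (y : 'rV[R]_n) : y != 0 -> cons_rV (0, y) != 0.
Proof.
apply: contra => /eqP e; apply/eqP/rowP => j.
by rewrite -(cons_rV_tail 0) e !mxE.
Qed.

Lemma cons_rV_head_neq0 n (c : R) : c != 0 -> cons_rV (c, 0 : 'rV[R]_n) != 0.
Proof.
apply: contra => /eqP e; apply/eqP.
by rewrite -(cons_rV_head c (0 : 'rV[R]_n)) e mxE.
Qed.

(** For [m = 1] the only edge is the last one and may use any coordinate, so lifting a segment from
    a slice preserves alignment. *)
Lemma aligned_box_slice n (A : set 'rV[R]_n.+1) (t V : R) :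
  aligned_box 1 (slice A t) V -> aligned_box 1 A V.
Proof.
move=> [p [v [v0 cv vV vA]]]; exists (cons_rV (t, p)), (fun j => cons_rV (0, v j)).
split.
- by move=> j; exact: cons_rV_tail_neq0.
- by move=> j i _; rewrite minn0 ord1.
- by rewrite -vV /box_volume; apply: eq_bigr => j _; rewrite enorm_cons_tail.
- by move=> T; rewrite /box_vertex cons_rV_sum cons_rVD addr0; exact: vA.
Qed.

(** The new edge, of length [c] along the first axis, gets index 0 and the others move up by one,
    together with their coordinates. A vertex lies in the slice at [t + c] or at [t] according to
    whether its index set contains 0. *)
Lemma aligned_box_cons m n (A : set 'rV[R]_n.+1) (t c V : R) : (0 < m)%N -> 0 < c ->
  aligned_box m (slice A t `&` slice A (t + c)) V -> aligned_box m.+1 A (c * V).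
Proof.
move=> m0 c0 [p [v [v0 cv vV vA]]].
pose v' (j : 'I_m.+1) : 'rV[R]_n.+1 :=
  if unlift ord0 j is Some j' then cons_rV (0, v j') else cons_rV (c, 0).
have v'0 : v' ord0 = cons_rV (c, 0) by rewrite /v' unlift_none.
have v'S j : v' (lift ord0 j) = cons_rV (0, v j) by rewrite /v' liftK.
exists (cons_rV (t, p)), v'; split.
- move=> j; case: (unliftP ord0 j) => [j'|] ->.
    by rewrite v'S cons_rV_tail_neq0.
  by rewrite v'0 cons_rV_head_neq0// gt_eqF.
- move=> j i; case: (unliftP ord0 j) => [j'|] ->; case: (unliftP ord0 i) => [i'|] ->.
  + rewrite v'S cons_rV_tail => /cv e.
    by rewrite /= /bump /= !add1n -e -[in LHS](prednK m0) minnSS.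
  + by rewrite v'S cons_rV_head eqxx.
  + by rewrite v'0 cons_rV_tail mxE eqxx.
  + by rewrite min0n.
- rewrite /box_volume big_ord_recl v'0 enorm_cons_head ?(ltW c0)// -vV.
  by congr (_ * _); apply: eq_bigr => j _; rewrite v'S enorm_cons_tail.
- move=> T; rewrite /box_vertex big_mkcond big_ord_recl /=.
  rewrite (eq_bigr (fun j => cons_rV (0, if lift ord0 j \in T then v j else 0))); last first.
    by move=> j _; rewrite v'S; case: ifP => // _; rewrite cons_rV0.
  rewrite cons_rV_sum v'0.
  pose T' : {set 'I_m} := finset (fun j : 'I_m => lift ord0 j \in T).
  have [At Atc] := vA T'.
  have E : \sum_(i < m) (if lift ord0 i \in T then v i else 0) =
      \sum_(j in T') v j.
    by rewrite [RHS]big_mkcond; apply: eq_bigr => j _; rewrite inE.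
  case: ifP => _; rewrite E ?add0r !cons_rVD ?addr0 ?add0r; first exact: Atc.
  exact: At.
Qed.

Lemma contains_boxes_dim n : contains_boxes R 1 n -> contains_boxes R 1 n.+1.
Proof.
move=> IH d VV d0 VVoo.
have d4 : 0 < d / 4 by rewrite divr_gt0.
have [R0 R00 HR] := IH (d / 4) VV d4 VVoo.
exists (R0 + 1) => [|r x A Rr mA Ax dA]; first by rewrite addr_gt0.
have r1 : 1 <= r by lra.
have r0 : 0 <= r by lra.
have dv : d * r ^+ n.+1 <= vol A by rewrite -lee_fin (EFin_vol r0 mA Ax).
have [t] := shifted_slices_large r0 mA Ax (isT : (0 < 1)%N) r1 r1 d0 dv.
rewrite mul1r big_ord1 => Ht.
have [||||V [VV_ V0 bV]] := HR r (behead_rV x) (slice A (t + (0%N)%:R)).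
- by lra.
- exact: measurable_slice.
- exact: slice_cube.
- rewrite -(EFin_vol r0 _ (slice_cube Ax)); last exact: measurable_slice.
  by rewrite lee_fin.
by exists V; split => //; exact: aligned_box_slice bV.
Qed.

(** Integer shifts leave only finitely many possible lengths for the new edge, so one [R0] serves
    all the rescaled sets of volumes. *)
Lemma contains_boxes_step m n : (0 < m)%N ->
  contains_boxes R m n -> contains_boxes R m.+1 n.+1.
Proof.
move=> m0 IH d VV d0 VVoo.
(* The [k] slices then have total volume at least [3 * r ^+ n]. If all pairwise intersections were
   smaller than [r ^+ n / k ^+ 2], [bonferroni] would allow at most [2 * r ^+ n]. *)
have [k k0 kd] := nat_above (12 / d).
have kr : 0 < k%:R :> R by rewrite ltr0n.
have kd' : 3 <= k%:R * (d / 4).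
  by move: kd; rewrite ler_pdivrMr//; lra.
pose d' : R := (k%:R ^+ 2)^-1.
have d'0 : 0 < d' by rewrite invr_gt0 exprn_gt0.
have VVc (c : nat) : (0 < c)%N -> forall M : R, exists2 V, VV (c%:R * V) & M <= V.
  move=> c0 M; have cr : 0 < c%:R :> R by rewrite ltr0n.
  have [V VV_ MV] := VVoo (c%:R * M); exists (V / c%:R).
    by rewrite mulrC divfK ?gt_eqF.
  by rewrite ler_pdivlMr// mulrC.
(* The index [c] stands for the shift [c.+1], which excludes the shift 0. *)
pose VVs (c : nat) : set R := [set V | VV (c.+1%:R * V)].
have HR c : exists2 R0 : R, 0 < R0 & forall r (x : 'rV[R]_n) (A : set 'rV[R]_n),
    R0 <= r -> measurable A -> A `<=` cube x r ->
    ((d' * r ^+ n)%:E <= borel_lebesgue A)%E ->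
    exists V, [/\ VVs c V, 0 < V & aligned_box m A V].
  exact: (IH d' (VVs c) d'0 (VVc c.+1 isT)).
have /all_sig2[R0 R00 HR0] := fun c => cid2 (HR c).
have s0 : 0 <= \sum_(c < k) R0 c by apply: sumr_ge0 => c _; exact: ltW.
exists (\sum_(c < k) R0 c + k%:R + 1) => [|r x A Rr mA Ax dA].
  by apply: ltr_wpDl => //; apply: addr_ge0.
have r1 : 1 <= r by lra.
have kr' : k%:R <= r by lra.
have r0 : 0 <= r by lra.
have dv : d * r ^+ n.+1 <= vol A by rewrite -lee_fin (EFin_vol r0 mA Ax).
have [t Ht] := shifted_slices_large r0 mA Ax k0 r1 kr' d0 dv.
pose B (a : 'I_k) := slice A (t + a%:R).
have mB a : measurable (B a) by exact: measurable_slice.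
have BC a : B a `<=` cube (behead_rV x) r by exact: slice_cube.
have mC := measurable_cube (behead_rV x) r.
have Coo : (borel_lebesgue (cube (behead_rV x) r) < +oo)%E.
  by rewrite borel_lebesgue_cube// ltry.
have vC : vol (cube (behead_rV x) r) = r ^+ n by rewrite /vol borel_lebesgue_cube.
have bon : \sum_a vol (B a) <= r ^+ n + \sum_a \sum_(b | b != a) vol (B a `&` B b).
  by rewrite -vC; exact: bonferroni.
have rn : 0 < r ^+ n by rewrite exprn_gt0// (lt_le_trans ltr01).
have [a [b [ba Bab]]] : exists a b : 'I_k, b != a /\ d' * r ^+ n <= vol (B a `&` B b).
  apply: contrapT => H; move: bon; apply/negP; rewrite -ltNge.
  apply: lt_le_trans Ht; apply: (@le_lt_trans _ _ (2 * r ^+ n)); last first.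
    by rewrite ltr_pM2r//; lra.
  rewrite mulr_natl mulr2n lerD2l.
  apply: (@le_trans _ _ (\sum_(a < k) \sum_(b < k) d' * r ^+ n)).
    apply: ler_sum => a _; rewrite [leRHS](bigID (fun b => b != a)) /= -[leLHS]addr0.
    apply: lerD; last by apply: sumr_ge0 => b _; rewrite mulr_ge0// ltW.
    apply: ler_sum => b ba; rewrite leNgt; apply/negP => h; apply: H.
    by exists a, b; split => //; exact: ltW.
  rewrite !sumr_const !card_ord -[_ *+ k *+ k]mulrnA -[_ *+ (k * k)]mulr_natl natrM -expr2.
  by rewrite mulrA divff ?mul1r// gt_eqF// exprn_gt0.
wlog ab : a b ba Bab / (a < b)%N.
  move=> W; case: (ltngtP a b) => ab; first exact: W ab.
    by apply: (W b a) ab; [rewrite eq_sym|rewrite setIC].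
  by move: ba; rewrite -(inj_eq val_inj) /= ab eqxx.
pose c := (b - a).-1.
have cba : c.+1 = (b - a)%N by rewrite /c prednK// subn_gt0.
have ck : (c < k)%N.
  by rewrite cba; apply: leq_trans (leq_subr _ _) _; exact: ltnW.
have Rc : R0 c <= r.
  apply: (@le_trans _ _ (\sum_(c < k) R0 c)); last by lra.
  by rewrite (bigD1 (Ordinal ck)) //= lerDl; apply: sumr_ge0 => i _; exact: ltW.
have mBab : measurable (B a `&` B b) by exact: measurableI.
have BabC : B a `&` B b `<=` cube (behead_rV x) r by move=> y [/BC].
have Bab' : ((d' * r ^+ n)%:E <= borel_lebesgue (B a `&` B b))%E.
  by rewrite -(EFin_vol r0 mBab BabC) lee_fin.
have [V [VVV V0 bV]] := HR0 c r _ _ Rc mBab BabC Bab'.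
exists (c.+1%:R * V); split => //; first by rewrite mulr_gt0// ltr0n.
apply: (@aligned_box_cons _ _ _ (t + a%:R)) => //.
have -> : t + a%:R + c.+1%:R = t + b%:R.
  by rewrite cba natrB ?(ltnW ab)//; ring.
exact: bV.
Qed.

End Induction.


(** * Segments in the plane, and the induction *)

Section Base.
Context (R : realType).
Local Notation mu := (@lebesgue_measure R).

Let emb (z : measurableTypeR R * measurableTypeR R) : 'rV[R]_2 :=
  cons_rV (z.1, cons_rV (z.2, 0 : 'rV[R]_0)).

Let measurable_emb : measurable_fun setT emb.
Proof.
apply: (measurableT_comp (@measurable_cons_rV R 1)).
apply: measurable_fun_pair; first exact: measurable_fst.
apply: (measurableT_comp (@measurable_cons_rV R 0)).
by apply: measurable_fun_pair; first exact: measurable_snd.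
Qed.

Lemma borel_lebesgue1 (C : set 'rV[R]_1) : measurable C ->
  borel_lebesgue C = mu [set u | C (cons_rV (u, 0 : 'rV[R]_0))].
Proof.
move=> mC; rewrite borel_lebesgue_slice.
have mD : measurable [set u : measurableTypeR R | C (cons_rV (u, 0 : 'rV[R]_0))].
  rewrite -[X in measurable X]setTI.
  have : measurable_fun setT (fun u : measurableTypeR R => cons_rV (u, 0 : 'rV[R]_0)).
    apply: (measurableT_comp (@measurable_cons_rV R 0)).
    by apply: measurable_fun_pair.
  by apply.
rewrite -[in RHS](setIT [set u | _]) -integral_indic//.
Qed.

Lemma contains_boxes12 : contains_boxes R 1 2.
Proof.
move=> d VV d0 VVoo; have [R0 R00 HR] := plane_distance d0 VVoo.
exists R0 => // r x A Rr mA Ax dA.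
have r0 : 0 <= r by apply: ltW; exact: lt_le_trans Rr.
pose B := emb @^-1` A.
have mB : measurable B by rewrite -[X in measurable X]setTI; exact: measurable_emb.
pose j1 : 'I_2 := lift ord0 ord0.
have lenB s : length (xsection B s) = vol (slice A s).
  rewrite /length /vol borel_lebesgue1; last exact: measurable_slice.
  congr (fine (mu _)); apply/seteqP; split => u; rewrite /xsection /B /slice /= inE //.
have [||v [s [u [s' [u' [VVv v0 Bs Bs' e]]]]]] := HR r (x 0 ord0) (x 0 j1) B Rr mB.
- move=> [s u] /Ax h; split => /=; rewrite in_itv /=.
    by have := h ord0; rewrite /emb cons_rV_head.
  by have := h j1; rewrite /emb /j1 cons_rV_tail cons_rV_head.
- under eq_Rintegral do rewrite lenB.
  by rewrite (int_slice r0 mA Ax) -lee_fin (EFin_vol r0 mA Ax).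
exists v; split => //.
pose w : 'rV[R]_2 := cons_rV (s' - s, cons_rV (u' - u, 0 : 'rV[R]_0)).
have wv : enorm w = v.
  rewrite /enorm /w !dotv_cons /dotv big_ord0 addr0 -!expr2 e sqrtr_sqr.
  by rewrite ger0_norm// ltW.
exists (emb (s, u)), (fun=> w); split.
- move=> _; apply/eqP => w0; move: v0; rewrite -wv w0 /enorm /dotv big1 => [|i _].
    by rewrite sqrtr0 ltxx.
  by rewrite mxE mul0r.
- by move=> j i _; rewrite minn0 ord1.
- by rewrite /box_volume big_ord1.
- move=> T; rewrite /box_vertex big_mkcond big_ord1; case: ifP => _; last by rewrite addr0.
  by rewrite /emb /w !cons_rVD addr0 /= [s + _]addrC [u + _]addrC !subrK.
Qed.

(** The step raises [m] and [n] together, so it ends at [m = 1] with some [n >= 2], which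
    [contains_boxes_dim] reaches from the plane. *)
Theorem contains_boxes_gen m n : (0 < m)%N -> (m < n)%N -> contains_boxes R m n.
Proof.
case: m => // m _; elim: m n => [|m IH] n mn.
  elim: n mn => // n IHn; rewrite ltnS leq_eqVlt => /orP[/eqP <-|/IHn].
    exact: contains_boxes12.
  exact: contains_boxes_dim.
case: n mn => // n mn; apply: contains_boxes_step => //.
exact: IH.
Qed.

End Base.


(** * From Borel sets in cubes to Lebesgue measurable sets and densities *)

Section Lebesgue.
Context (R : realType) (n : nat).
Implicit Types (A B C : set 'rV[R]_n).
Local Notation bl := (@borel_lebesgue R n).

Lemma lebesgue_rV_borel B : measurable B -> lebesgue_rV B = borel_lebesgue B.
Proof. exact: measurable_mu_extE. Qed.

Lemma le_lebesgue_rV A B : A `<=` B -> (lebesgue_rV A <= lebesgue_rV B)%E.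
Proof. exact: le_mu_ext. Qed.

Lemma lebesgue_rV_ge0 A : (0 <= lebesgue_rV A)%E.
Proof. by apply: mu_ext_ge0 => X; exact: measure_ge0. Qed.

Lemma lebesgue_rV_cube (x : 'rV[R]_n) r : 0 <= r ->
  lebesgue_rV (cube x r) = (r ^+ n)%:E.
Proof.
move=> r0; rewrite lebesgue_rV_borel; first exact: borel_lebesgue_cube.
exact: measurable_cube.
Qed.

Lemma lebesgue_rV_cube_fin A (x : 'rV[R]_n) r : 0 <= r ->
  lebesgue_rV (A `&` cube x r) \is a fin_num.
Proof.
move=> r0; rewrite ge0_fin_numE ?lebesgue_rV_ge0//.
by apply: le_lt_trans (le_lebesgue_rV (@subIsetr _ _ _)) _; rewrite lebesgue_rV_cube ?ltry.
Qed.

Lemma borel_cover C (e : R) : 0 < e -> lebesgue_rV C \is a fin_num ->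
  exists B, [/\ measurable B, C `<=` B & (borel_lebesgue B <= lebesgue_rV C + e%:E)%E].
Proof.
move=> e0 Cfin; have [_ [F [mF CF] <-] lt_] := lb_ereal_inf_adherent e0 Cfin.
exists (\bigcup_k F k); split => //; first exact: bigcupT_measurable.
apply: le_trans (ltW lt_); apply: measure_sigma_subadditive => //.
exact: bigcupT_measurable.
Qed.

(** Remove from the cube a Borel cover of the part outside [A]. The criterion of Caratheodory,
    tested on the cube, turns the excess of the cover into the defect of what is left. *)
Lemma inner_borel A (x : 'rV[R]_n) (r e : R) : lebesgue_measurable A -> 0 <= r -> 0 < e ->
  exists B, [/\ measurable B, B `<=` A `&` cube x r &
    (lebesgue_rV (A `&` cube x r) <= borel_lebesgue B + e%:E)%E].
Proof.
move=> mA r0 e0; set C := cube x r.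
have mC : measurable C by exact: measurable_cube.
have split_C : lebesgue_rV C = (lebesgue_rV (A `&` C) + lebesgue_rV (~` A `&` C))%E.
  by rewrite ![_ `&` C]setIC; exact: mA.
have fA := lebesgue_rV_cube_fin A x r0; have fA' := lebesgue_rV_cube_fin (~` A) x r0.
have [G [mG GC bG]] := borel_cover e0 fA'.
exists (C `\` G); split; first exact: measurableD.
  move=> y [Cy nG]; split => //; apply: contrapT => nA; apply: nG; exact: GC.
have CG : (borel_lebesgue C <= borel_lebesgue (C `\` G) + borel_lebesgue G)%E.
  apply: le_trans (measureU2 bl (measurableD mC mG) mG).
  apply: le_measure; rewrite ?inE//; first by apply: measurableU => //; exact: measurableD.
  by move=> y Cy; have [Gy|nG] := pselect (G y); [right|left].
rewrite -(leeD2rE _ _ fA') -split_C lebesgue_rV_borel//.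
by apply: (le_trans CG); rewrite -addeA leeD2l// addeC.
Qed.

(** The common consequence of the hypotheses of (a) and (b): a fixed density in some arbitrarily
    large cubes. *)
Definition dense_in_cubes A := exists2 d : R, 0 < d & forall R0 : R,
  exists r (x : 'rV[R]_n), R0 <= r /\ ((d * r ^+ n)%:E <= lebesgue_rV (A `&` cube x r))%E.

Lemma not_dense_in_cubes A (d : R) : ~ dense_in_cubes A -> 0 < d ->
  exists R0 : R, forall r (x : 'rV[R]_n), R0 <= r ->
    (lebesgue_rV (A `&` cube x r) < (d * r ^+ n)%:E)%E.
Proof.
move=> nA d0; apply: contrapT => H; apply: nA; exists d => // R0.
apply: contrapT => H'; apply: H; exists R0 => r x Rr.
by rewrite ltNge; apply/negP => h; apply: H'; exists r, x.
Qed.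

(** If no [V0] worked, the missed volumes would be unbounded and [contains_boxes_gen] would realise
    one of them. Half of the density is given up for the Borel approximation. *)
Lemma dense_boxes m A : (0 < m)%N -> (m < n)%N -> lebesgue_measurable A ->
  dense_in_cubes A ->
  exists V0 : R, 0 < V0 /\ forall V, V0 <= V -> aligned_box m A V.
Proof.
move=> m0 mn mA [d d0 dA]; apply: contrapT => H.
have VVoo M : exists2 V, [set V | ~ aligned_box m A V] V & M <= V.
  apply: contrapT => HM; apply: H; exists (Num.max M 1).
  split; first by rewrite lt_max ltr01 orbT.
  move=> V; rewrite ge_max => /andP[MV _]; apply: contrapT => nV.
  by apply: HM; exists V.
have d2 : 0 < d / 2 by rewrite divr_gt0.
have [R0 R00 HR] := contains_boxes_gen m0 mn d2 VVoo.
have [r [x [Rr dx]]] := dA R0.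
have r0 : 0 < r by exact: lt_le_trans Rr.
have e0 : 0 < d / 2 * r ^+ n by rewrite mulr_gt0// exprn_gt0.
have [B [mB BA Be]] := inner_borel x mA (ltW r0) e0.
have [||V [nV _ [p [v [v0 cv vV vA]]]]] := HR r x B Rr mB.
- by move=> y /BA [].
- rewrite -(leeD2rE _ _ (_ : (d / 2 * r ^+ n)%:E \is a fin_num))//.
  by apply: le_trans Be; apply: le_trans dx; rewrite -EFinD lee_fin; lra.
by apply: nV; exists p, v; split => // T; have [] := BA _ (vA T).
Qed.

Lemma upper_banach_density_dense A : (0 < upper_banach_density A)%E -> dense_in_cubes A.
Proof.
move=> dA; apply: contrapT => nA; move: dA; apply/negP; rewrite -leNgt.
apply/lee_addgt0Pr => e e0; rewrite add0e.
have [R0 HR] := not_dense_in_cubes nA e0.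
pose F (r : R) : \bar R := ereal_sup [set (lebesgue_rV (A `&` cube x r) * ((r ^+ n)^-1)%:E)%E
       | x in [set: 'rV[R]_n]].
apply: (@le_trans _ _ (ereal_sup (F @` [set r | Num.max R0 1 < r]))).
  apply: ereal_inf_lbound; exists [set r | Num.max R0 1 < r] => //.
  by exists (Num.max R0 1); split => //; exact: num_real.
apply: ge_ereal_sup => _ [r Rr <-]; apply: ge_ereal_sup => _ [x _ <-].
move: Rr; rewrite /= gt_max => /andP[Rr r1].
have rn : 0 < r ^+ n by rewrite exprn_gt0// (lt_trans ltr01).
have := HR r x (ltW Rr); have := lebesgue_rV_cube_fin A x (ltW (lt_trans ltr01 r1)).
case: (lebesgue_rV _) => // v _; rewrite lte_fin => hv.
by rewrite -EFinM lee_fin ler_pdivrMr// ltW.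
Qed.

(** Otherwise, in one cube that is large for all classes, each of the [k] classes fills less than
    [1 / (2 * k)], and together they cover at most half of it. *)
Lemma coloring_dense k (C : 'I_k -> set 'rV[R]_n) : measurable_coloring C ->
  exists c, dense_in_cubes (C c).
Proof.
move=> [[CT _ _] mC]; apply: contrapT => H.
have nC c : ~ dense_in_cubes (C c) by move=> h; apply: H; exists c.
have k0 : (0 < k)%N.
  have : cover [set: 'I_k] C 0 by rewrite CT.
  by move=> [c _ _]; exact: leq_ltn_trans (ltn_ord c).
have kr : 0 < k%:R :> R by rewrite ltr0n.
have d0 : 0 < (2 * k%:R)^-1 :> R by rewrite invr_gt0 mulr_gt0.
have /all_sig[R0 HR] := fun c => cid (not_dense_in_cubes (nC c) d0).
pose r : R := 1 + \sum_c `|R0 c|.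
have s0 : 0 <= \sum_c `|R0 c| by exact: sumr_ge0.
have r0 : 0 < r by rewrite /r; lra.
have Rr c : R0 c <= r.
  apply: (le_trans (ler_norm _)); rewrite /r (bigD1 c) //= addrCA lerDl.
  by rewrite addr_ge0// sumr_ge0.
have rn : 0 < r ^+ n by rewrite exprn_gt0.
have : (lebesgue_rV (cube (0 : 'rV[R]_n) r) <= (r ^+ n / 2)%:E)%E.
  pose D (i : nat) : set 'rV[R]_n :=
    if insub i is Some c then C c `&` cube 0 r else set0.
  have cD : cube (0 : 'rV[R]_n) r `<=` \big[setU/set0]_(i < k) D i.
    move=> y cy; have : cover [set: 'I_k] C y by rewrite CT.
    move=> [c _ Cy]; rewrite (bigD1 c) //=; left.
    by rewrite /D insubT//= => ?; split => //; move: Cy; congr (C _ y); exact/val_inj.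
  apply: (le_trans (le_lebesgue_rV cD)).
  apply: (le_trans (outer_measure_subadditive (bl^*)%mu D k)).
  apply: (@le_trans _ _ (\sum_(i < k) ((2 * k%:R)^-1 * r ^+ n)%:E)%E).
    apply: lee_sum => i _; rewrite /D insubT//= => ?.
    by apply: ltW; exact: HR.
  rewrite sumEFin lee_fin sumr_const card_ord -[_ *+ k]mulr_natl.
  by rewrite le_eqVlt; apply/orP; left; apply/eqP; field; rewrite gt_eqF.
rewrite lebesgue_rV_cube ?(ltW r0)// lee_fin; lra.
Qed.

End Lebesgue.

Theorem theorem5 (R : realType) (m n : nat) (hm : (0 < m)%N)
    (hmn : (m + 1 <= n)%N) :
  (forall A : set 'rV[R]_n,
     lebesgue_measurable A -> (0 < upper_banach_density A)%E ->
     exists V0 : R, 0 < V0 /\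
       forall V : R, V0 <= V ->
         exists (p : 'rV[R]_n) (v : 'I_m -> 'rV[R]_n),
           [/\ box_edges v, edges_aligned v, box_volume v = V &
               forall T : {set 'I_m}, A (box_vertex p v T)])
  /\
  (forall (k : nat) (C : 'I_k -> set 'rV[R]_n),
     measurable_coloring C ->
     exists (c : 'I_k) (V0 : R), 0 < V0 /\
       forall V : R, V0 <= V ->
         exists (p : 'rV[R]_n) (v : 'I_m -> 'rV[R]_n),
           [/\ box_edges v, edges_aligned v, box_volume v = V &
               forall T : {set 'I_m}, C c (box_vertex p v T)]).
Proof.
have mn : (m < n)%N by rewrite addn1 in hmn.
split => [A mA /upper_banach_density_dense dA|k C CC].
  have [V0 [V00 HV]] := dense_boxes hm mn mA dA.
  by exists V0; split => // V /HV; exact: aligned_boxP.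
have [c dc] := coloring_dense CC; exists c.
have [V0 [V00 HV]] := dense_boxes hm mn (CC.2 c) dc.
by exists V0; split => // V /HV; exact: aligned_boxP.
Qed.
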